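(* Consider a sequence of random variables $(X_n)$ defined recursively by \[ X_n\overset{d}{=}t_n+X_{K_n}+\widetilde X_{n-a-K_n}, \] where, for each $n$, the random index $K_n$ has distribution $\mathbb{P}(K_n=k)=p_{n,k}$, the families $(X_k)$, $(\widetilde X_k)$ and $K_n$ are independent, and $\widetilde X_k$ has the same distribution as $X_k$; the model is one of: (BST) $a=1$, $p_{n,k}=1/n$ for $k=0,\dots,n-1$, $X_0=t_0$; (uniform binary tree) $a=1$, $p_{n,k}=C_kC_{n-1-k}/C_n$ for $k=0,\dots,n-1$, with $C_n=\frac{1}{n+1}\binom{2n}{n}$, $X_0=t_0$; (union--find) $a=0$, $p_{n,k}=\binom{n}{k}\frac{k^{k-1}(n-k)^{n-k-1}}{2(n-1)n^{n-2}}$ for $k=1,\dots,n-1$ ($n\ge2$), $X_1=t_1$. Let the deterministic toll be $t_n=n^{\alpha}$ for a fixed $\alpha>0$, or $t_n=\log n$ (with $t_0=0$). Then for every integer $s>0$, the $s$th moment $\mathbb{E}(X_n^s)$ admits, as $n\to\infty$, a complete asymptotic expansion in descending powers of $n$, possibly with (integral powers of) logarithmic terms $\log n$. *)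

(* Defs.v *)
From HB Require Import structures.
From mathcomp Require Import all_boot all_order all_algebra.
From mathcomp Require Import all_classical all_reals all_analysis.
Set Implicit Arguments.
Unset Strict Implicit.
Unset Printing Implicit Defensive.
Import Order.TTheory GRing.Theory Num.Theory.
Import numFieldNormedType.Exports.
Local Open Scope classical_set_scope.
Local Open Scope ring_scope.

Inductive tree_model := BST | UniformBinary | UnionFind.

Definition shift (M : tree_model) : nat :=
  match M with BST | UniformBinary => 1 | UnionFind => 0 end.

(* The index of the initial condition; the recurrence holds strictly above. *)
Definition base (M : tree_model) : nat :=
  match M with BST | UniformBinary => 0 | UnionFind => 1 end.

Definition catalan (R : realType) (n : nat) : R := 'C(n.*2, n)%:R / n.+1%:R.

(* Only used for n > base M; outside the stated range of k the value is 0, so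
   that split_prob R M n is the whole mass function of K_n. *)
Definition split_prob (R : realType) (M : tree_model) (n k : nat) : R :=
  match M with
  | BST => if (k < n)%N then n%:R^-1 else 0
  | UniformBinary =>
      if (k < n)%N then catalan R k * catalan R (n - 1 - k) / catalan R n else 0
  | UnionFind =>
      if (0 < k < n)%N then
        'C(n, k)%:R * (k%:R ^+ (k - 1) * (n - k)%:R ^+ (n - k - 1))
          / (2 * (n - 1)%:R * n%:R ^+ (n - 2))
      else 0
  end.

Definition power_toll (R : realType) (alpha : R) (n : nat) : R :=
  n%:R `^ alpha.

Definition log_toll (R : realType) (n : nat) : R :=
  if n == 0%N then 0 else ln n%:R.

Definition admissible_toll (R : realType) (t : nat -> R) : Prop :=
  (exists2 alpha : R, 0 < alpha & t = power_toll alpha) \/ t = @log_toll R.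

Section Probability.
Context (d : measure_display) (T : measurableType d) (R : realType).
Variable P : probability T R.

Definition same_distribution (Y Z : T -> R) : Prop :=
  forall B : set R, measurable B -> P (Y @^-1` B) = P (Z @^-1` B).

Definition sigma_of (d' : measure_display) (T' : measurableType d')
    (Y : T -> T') : set (set T) :=
  preimage_set_system setT Y measurable.

Definition sigma_of_family (Y : nat -> T -> R) : set (set T) :=
  <<s \bigcup_k sigma_of (Y k) >>.

(* Since each sigma-algebra contains the whole space, the triple product rule
   entails the pairwise ones. *)
Definition independent3 (F G H : set (set T)) : Prop :=
  forall A B C, F A -> G B -> H C -> P (A `&` B `&` C) = (P A * P B * P C)%E.

Record tree_recurrence (M : tree_model) (t : nat -> R)
    (X Xt : nat -> {RV P >-> R}) (K : nat -> {RV P >-> nat}) : Prop := {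
  initial_value : {ae P, forall w, X (base M) w = t (base M)};
  copy_distribution : forall k, same_distribution (X k) (Xt k);
  index_distribution : forall n k : nat, (base M < n)%N ->
    P (K n @^-1` [set k]) = (split_prob R M n k)%:E;
  index_independent : forall n, (base M < n)%N ->
    independent3 (sigma_of_family (fun k => X k))
      (sigma_of_family (fun k => Xt k)) (sigma_of (K n));
  recurrence : forall n, (base M < n)%N ->
    same_distribution (X n)
      (fun w => t n + X (K n w) w + Xt (n - shift M - K n w)%N w)
}.

End Probability.

(* u n ~ \sum_j (Q j).[ln n] * n ^ (beta j), with real exponents beta j
   decreasing to -oo and coefficients polynomial in ln n.  Null polynomials are
   allowed, so that a terminating expansion is a particular case. *)
Definition complete_expansion (R : realType) (u : nat -> R) : Prop :=
  exists (beta : nat -> R) (Q : nat -> {poly R}),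
    [/\ forall j, beta j.+1 < beta j,
        beta n @[n --> \oo] --> -oo
      & forall J : nat, exists (m : nat) (c : R), \forall n \near \oo,
          `|u n - \sum_(j < J) (Q j).[ln n%:R] * n%:R `^ beta j|
            <= c * (n%:R `^ beta J * ln n%:R ^+ m)].

(* Main.v *)
(** By induction each [X n] is almost surely finitely valued, and its moments
    satisfy a recurrence which, once the lower moments are known, is linear:
    [f n = g n + 2 * \sum_k p n k * f k], with [g] built from the toll and from
    products [\sum_k p n k * u k * v (n - a - k)] of lower moments.

    Call a sequence expandable when for every [B] it is a finite combination of
    terms [n^b ln^k n] up to [O(n^-B)].  Such sequences are stable under
    products, shifts, antidifferences and convolution.  For the convolution, the
    derivation [(1 - z) d/dz] maps [n^b ln^k n] to [(b + 1) n^b ln^k n +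
    k n^b ln^(k-1) n] plus terms of lower order, so that the convolution of two
    terms solves a first-order recurrence whose right-hand side is known by
    induction; rapidly decreasing remainders are split off by summation by parts.

    The linear recurrences are then solved explicitly.  For BST, differencing
    gives [(n + 1) f (n + 1) = (n + 2) f n + y n].  For uniform binary trees,
    [C f] is the convolution of [C g] with the central binomial coefficients.
    For union-find, let [T] be the tree function, [th = z d/dz], [Phi] the series
    of [T_n f_n] and [H] that of [(n - 1) T_n g_n]; then [Psi = Phi (1 - T) exp(-T)]
    satisfies [th Psi - Psi = exp(-T) H], and [z Phi = Psi * th T].  The only
    combinatorial identity needed, [(1 - T) th T = T], says that the masses
    [p n k] add up to 1.

    Uniqueness of asymptotic expansions glues the expansions to every order
    into a single one. *)

Require Import Defs.
From HB Require Import structures.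
From mathcomp Require Import all_boot all_order all_algebra.
From mathcomp Require Import all_classical all_reals all_analysis.
From mathcomp Require Import ring lra zify.
Set Implicit Arguments.
Unset Strict Implicit.
Unset Printing Implicit Defensive.
Import Order.TTheory GRing.Theory Num.Theory.
Import numFieldNormedType.Exports.
Local Open Scope classical_set_scope.
Local Open Scope ring_scope.

(** * Power bounds *)

Section BigO.
Variable R : realType.
Implicit Types (e b c C : R) (u v w : nat -> R).

Local Notation xn n := (n.+1%:R : R).

Lemma xn_gt0 n : 0 < xn n. Proof. by rewrite ltr0n. Qed.
Lemma xn_ge1 n : 1 <= xn n. Proof. by rewrite ler1n. Qed.
Lemma xn_neq0 n : xn n != 0. Proof. by rewrite pnatr_eq0. Qed.
Lemma pow_xn_gt0 n e : 0 < xn n `^ e. Proof. exact/powR_gt0/xn_gt0. Qed.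
Hint Resolve xn_gt0 xn_ge1 xn_neq0 pow_xn_gt0 : core.

Lemma pow_xnD n (e1 e2 : R) : xn n `^ (e1 + e2) = xn n `^ e1 * xn n `^ e2.
Proof. by rewrite powRD //; apply/implyP. Qed.

Lemma pow_xn_le n (e1 e2 : R) : e1 <= e2 -> xn n `^ e1 <= xn n `^ e2.
Proof. by move=> h; apply: ler_powR. Qed.

Lemma pow_xn1 n : xn n `^ 1 = xn n. Proof. by rewrite powRr1. Qed.

Lemma pow_xnN1 n : xn n `^ (-1) = (xn n)^-1. Proof. by rewrite powR_inv1. Qed.

(* Sequences are compared with powers of [n + 1], so that no index is exceptional. *)
Definition bigo e u := exists C, forall n, `|u n| <= C * xn n `^ e.

Lemma bigo_ge0 e u : bigo e u ->
  exists2 C, 0 <= C & forall n, `|u n| <= C * xn n `^ e.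
Proof.
case=> C hC; exists `|C| => // n; apply: (le_trans (hC n)).
by rewrite ler_wpM2r ?ler_norm // ltW.
Qed.

Lemma bigo_ext e u v : u =1 v -> bigo e u -> bigo e v.
Proof. by move=> /funext ->. Qed.

Lemma bigoD e u v : bigo e u -> bigo e v -> bigo e (fun n => u n + v n).
Proof.
move=> [C hC] [D hD]; exists (C + D) => n.
by rewrite mulrDl (le_trans (ler_normD _ _)) // lerD.
Qed.

Lemma bigoN e u : bigo e u -> bigo e (fun n => - u n).
Proof. by move=> [C hC]; exists C => n; rewrite normrN. Qed.

Lemma bigoB e u v : bigo e u -> bigo e v -> bigo e (fun n => u n - v n).
Proof. by move=> hu hv; apply: bigoD => //; apply: bigoN. Qed.

Lemma bigoM e1 e2 u v : bigo e1 u -> bigo e2 v ->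
  bigo (e1 + e2) (fun n => u n * v n).
Proof.
move=> /bigo_ge0[C C0 hC] /bigo_ge0[D D0 hD]; exists (C * D) => n.
by rewrite pow_xnD normrM mulrACA ler_pM.
Qed.

Lemma bigo_le e1 e2 u : e1 <= e2 -> bigo e1 u -> bigo e2 u.
Proof.
move=> h /bigo_ge0[C C0 hC]; exists C => n; apply: (le_trans (hC n)).
by rewrite ler_wpM2l // pow_xn_le.
Qed.

Lemma bigo_pow e : bigo e (fun n => xn n `^ e).
Proof. by exists 1 => n; rewrite mul1r ger0_norm // ltW. Qed.

Lemma bigo_cst c : bigo 0 (fun=> c).
Proof. by exists `|c| => n; rewrite powRr0 mulr1. Qed.

Lemma bigoZ e c u : bigo e u -> bigo e (fun n => c * u n).
Proof. by move=> h; rewrite -[e]add0r; apply: bigoM => //; apply: bigo_cst. Qed.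

Lemma bigo0 e : bigo e (fun=> 0).
Proof. by exists 0 => n; rewrite normr0 mul0r. Qed.

Lemma bigo_eventually e u C N :
  (forall n, (N <= n)%N -> `|u n| <= C * xn n `^ e) -> bigo e u.
Proof.
(* The finitely many exceptional indices are paid for by adding their own ratios to the constant. *)
move=> h; exists (`|C| + \sum_(i < N) `|u i| / xn i `^ e) => n.
case: (leqP N n) => hn.
  apply: (le_trans (h n hn)); rewrite ler_wpM2r ?(ltW (pow_xn_gt0 _ _)) //.
  apply: (le_trans (ler_norm _)); rewrite lerDl; apply: sumr_ge0 => i _.
  by rewrite divr_ge0 // ltW.
rewrite mulrDl (bigD1 (Ordinal hn)) //= mulrDl divfK ?gt_eqF // addrCA lerDl.
apply: addr_ge0; apply: mulr_ge0 => //; rewrite ?powR_ge0 //.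
by apply: sumr_ge0 => i _; rewrite divr_ge0 ?powR_ge0.
Qed.

Lemma bigo_eventually_eq e u v N :
  (forall n, (N <= n)%N -> u n = v n) -> bigo e u -> bigo e v.
Proof. by move=> h [C hC]; apply: (@bigo_eventually e v C N) => n /h <-. Qed.

Lemma xnS_le n : xn n.+1 <= 2 * xn n.
Proof. by rewrite -natrM ler_nat; lia. Qed.

Lemma xn_leS n : xn n <= xn n.+1.
Proof. by rewrite ler_nat. Qed.

Lemma pow_le_homo (x y e : R) : 0 <= e -> 0 < x -> x <= y -> x `^ e <= y `^ e.
Proof. by move=> e0 x0 xy; rewrite ge0_ler_powR // nnegrE; lra. Qed.

Lemma pow_le_anti (x y e : R) : e <= 0 -> 0 < x -> x <= y -> y `^ e <= x `^ e.
Proof.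
move=> e0 x0 xy; rewrite -[e]opprK (powRN y) (powRN x) lef_pV2 ?posrE ?powR_gt0 //; last lra.
by apply: pow_le_homo => //; lra.
Qed.

Lemma pow_xnS_le n e : xn n.+1 `^ e <= 2 `^ `|e| * xn n `^ e.
Proof.
case: (lerP 0 e) => e0.
  rewrite ger0_norm // -powRM // pow_le_homo //; exact: xnS_le.
apply: (@le_trans _ _ (xn n `^ e)); first by apply: pow_le_anti; rewrite ?xn_leS ?(ltW e0).
rewrite ler_peMl ?(ltW (pow_xn_gt0 _ _)) // -[leLHS](powRr0 2) ler_powR ?ler1n //.
Qed.

Lemma pow_xn_leS n e : xn n `^ e <= 2 `^ `|e| * xn n.+1 `^ e.
Proof.
case: (lerP 0 e) => e0.
  apply: (@le_trans _ _ (xn n.+1 `^ e)); first by rewrite pow_le_homo ?xn_leS.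
  rewrite ler_peMl ?(ltW (pow_xn_gt0 _ _)) // -[leLHS](powRr0 2) ler_powR ?ler1n //.
rewrite ltr0_norm // powRN -ler_pdivrMl ?invr_gt0 ?powR_gt0 // invrK -powRM //.
by apply: pow_le_anti; rewrite ?xnS_le ?(ltW e0).
Qed.

Lemma bigo_shift e u : bigo e u -> bigo e (fun n => u n.+1).
Proof.
move=> /bigo_ge0[C C0 hC]; exists (C * 2 `^ `|e|) => n.
by rewrite (le_trans (hC _)) // -mulrA ler_wpM2l // pow_xnS_le.
Qed.

Lemma bigo_unshift e u : bigo e (fun n => u n.+1) -> bigo e u.
Proof.
move=> /bigo_ge0[C C0 hC].
apply: (@bigo_eventually e u (C * 2 `^ `|e|) 1) => -[//|n] _.
by rewrite (le_trans (hC _)) // -mulrA ler_wpM2l // pow_xn_leS.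
Qed.

Definition tau b k n : R := xn n `^ b * ln (xn n) ^+ k.

Lemma tauM b1 b2 k1 k2 n : tau b1 k1 n * tau b2 k2 n = tau (b1 + b2) (k1 + k2) n.
Proof. by rewrite /tau mulrACA -pow_xnD exprD. Qed.

Lemma ln_xn_ge0 n : 0 <= ln (xn n). Proof. exact: ln_ge0. Qed.

Lemma ln_xn_le n (e : R) : 0 < e -> ln (xn n) <= e^-1 * xn n `^ e.
Proof.
move=> e0; rewrite -ler_pdivrMl ?invr_gt0 // invrK -ln_powR.
by apply/ltW/ln_sublinear.
Qed.

Lemma bigo_tau e b k : b < e -> bigo e (tau b k).
Proof.
(* Each of the [k] logarithms costs a power [d]; dividing the gap by [k.+1] keeps [k * d] within it,
   also for [k = 0]. *)
move=> be; set d := (e - b) / k.+1%:R.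
have d0 : 0 < d by rewrite divr_gt0 // subr_gt0.
exists (d^-1 ^+ k) => n; rewrite /tau ger0_norm; last first.
  by rewrite mulr_ge0 ?exprn_ge0 ?ln_xn_ge0 // ltW.
have -> : e = b + (e - b) by ring.
rewrite pow_xnD mulrCA ler_wpM2l ?(ltW (pow_xn_gt0 _ _)) //.
apply: (@le_trans _ _ ((d^-1 * xn n `^ d) ^+ k)).
  by rewrite lerXn2r ?nnegrE ?ln_xn_ge0 ?mulr_ge0 ?invr_ge0 ?(ltW d0) ?ln_xn_le // ltW.
rewrite exprMn ler_wpM2l ?exprn_ge0 ?invr_ge0 ?(ltW d0) //.
rewrite -powR_mulrn ?(ltW (pow_xn_gt0 _ _)) // -powRrM pow_xn_le //.
rewrite /d mulrAC ler_pdivrMr // ler_wpM2l ?subr_ge0 ?(ltW be) //.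
by rewrite ler_nat.
Qed.

(** Discrete form of the integral of [x^e], with [x = n + 1]: the increment of [x^(e+1)] is
    estimated through [exp y >= 1 + y] and [ln (1 + 1/x) >= 1/(2x)]. The sign makes the increment
    positive on both sides of [e = -1], so that the bound telescopes. *)
Lemma pow_le_diff e : e != -1 -> exists2 K, 0 <= K & forall n,
  xn n `^ e <= K * (Num.sg (e + 1) * (xn n.+1 `^ (e + 1) - xn n `^ (e + 1))).
Proof.
move=> e1.
(* This is [ln (1 + y) <= y] at [y = -1/(x+1)], followed by [x + 1 <= 2x]. *)
have L n : (2 * xn n)^-1 <= ln (xn n.+1) - ln (xn n).
  rewrite -ln_div ?posrE // -[X in ln X]invrK lnV ?posrE ?invr_gt0 ?divr_gt0 //.
  rewrite lerNr; apply: (@le_trans _ _ (- (xn n.+1)^-1)); last first.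
    by rewrite lerN2 lef_pV2 ?posrE ?mulr_gt0 // xnS_le.
  have -> : (xn n.+1 / xn n)^-1 = 1 + - (xn n.+1)^-1.
    have h0 := xn_gt0 n; rewrite -[n.+2%:R]natr1; field.
    by apply/andP; split; rewrite gt_eqF //; lra.
  by apply: le_ln1Dx; rewrite ltrN2 invf_lt1 // ltr1n.
have E n (a : R) : xn n `^ a = expR (a * ln (xn n)) by rewrite /powR (negbTE (xn_neq0 n)).
case: (ltrgtP 0 (e + 1)) => h; last by move: e1; rewrite -subr_eq0 opprK -h eqxx.
  exists (2 / (e + 1)); first by rewrite divr_ge0 // ltW.
  move=> n; rewrite gtr0_sg // mul1r -ler_pdivrMl ?divr_gt0 // invf_div.
  have -> : xn n.+1 `^ (e + 1) = xn n `^ (e + 1) * expR ((e + 1) * (ln (xn n.+1) - ln (xn n))).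
    by rewrite !E -expRD; congr expR; ring.
  apply: (@le_trans _ _ (xn n `^ (e + 1) * ((e + 1) * (2 * xn n)^-1))).
    by rewrite pow_xnD pow_xn1 le_eqVlt; apply/orP; left; apply/eqP; field.
  rewrite -[X in _ <= _ - X]mulr1 -mulrBr ler_wpM2l ?(ltW (pow_xn_gt0 _ _)) //.
  rewrite lerBrDl (le_trans _ (expR_ge1Dx _)) // lerD2l ler_wpM2l //; exact: ltW.
(* Here the powers are compared at [x + 1]; the factor [2^-(e+1)] pays for replacing [x^(e+1)] by
   [(x+1)^(e+1)]. *)
exists (2 `^ (- (e + 1)) * (2 / - (e + 1))).
  by rewrite mulr_ge0 ?powR_ge0 // divr_ge0 //; lra.
move=> n; rewrite ltr0_sg // mulN1r opprB.
have -> : xn n `^ (e + 1) = xn n.+1 `^ (e + 1) * expR (- (e + 1) * (ln (xn n.+1) - ln (xn n))).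
  by rewrite !E -expRD; congr expR; ring.
rewrite -[X in _ <= _ * (_ - X)]mulr1 -mulrBr.
apply: (@le_trans _ _ (2 `^ (- (e + 1)) * (2 / - (e + 1)) *
    (xn n.+1 `^ (e + 1) * (- (e + 1) * (2 * xn n)^-1)))); last first.
  rewrite ler_wpM2l //; first by rewrite mulr_ge0 ?powR_ge0 // divr_ge0 //; lra.
  rewrite ler_wpM2l ?(ltW (pow_xn_gt0 _ _)) //.
  rewrite lerBrDl (le_trans _ (expR_ge1Dx _)) // lerD2l ler_wpM2l //; lra.
have h2 : 2 `^ (- (e + 1)) = (2 `^ (e + 1))^-1 :> R by rewrite powRN.
have le2 : xn n `^ (e + 1) <= (2 `^ (e + 1))^-1 * xn n.+1 `^ (e + 1).
  rewrite -ler_pdivrMl ?invr_gt0 ?powR_gt0 // invrK -powRM //.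
  by apply: pow_le_anti; rewrite ?xnS_le ?(ltW h).
have -> : xn n `^ e = xn n `^ (e + 1) / xn n.
  by rewrite pow_xnD pow_xn1 mulfK.
have -> : 2 `^ (- (e + 1)) * (2 / - (e + 1)) *
    (xn n.+1 `^ (e + 1) * (- (e + 1) * (2 * xn n)^-1)) =
   (2 `^ (e + 1))^-1 * xn n.+1 `^ (e + 1) / xn n.
  by rewrite h2; field; rewrite nat1r xn_neq0 gt_eqF ?powR_gt0 //= lt_eqF.
by rewrite ler_wpM2r // invr_ge0 ltW.
Qed.

(** The bound of [pow_le_diff] telescopes, and the initial value is absorbed since
    [(n+1)^(e+1) >= 1]. *)
Lemma bigo_sum_gtN1 e u : -1 < e -> bigo e (fun n => u n.+1 - u n) ->
  bigo (e + 1) u.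
Proof.
move=> e1 /bigo_ge0[C C0 hC].
have [|K K0 hK] := @pow_le_diff e; first by rewrite gt_eqF.
exists (C * K + `|u 0%N|) => n.
have sg1 : Num.sg (e + 1) = 1 by rewrite gtr0_sg //; lra.
have h : `|u n| <= `|u 0%N| + C * K * (xn n `^ (e + 1) - 1).
  elim: n => [|n ih]; first by rewrite powR1 subrr mulr0 addr0.
  have -> : u n.+1 = u n + (u n.+1 - u n) by ring.
  rewrite (le_trans (ler_normD _ _)) // (le_trans (lerD ih (hC n))) //.
  have := hK n; rewrite sg1 mul1r => /(ler_wpM2l C0); lra.
apply: (le_trans h).
have p1 : 1 <= xn n `^ (e + 1) by rewrite -[leLHS](powRr0 (xn n)) pow_xn_le; lra.
have : `|u 0%N| <= `|u 0%N| * xn n `^ (e + 1) by rewrite ler_peMr.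
have : 0 <= C * K by rewrite mulr_ge0.
by rewrite mulrDl; lra.
Qed.

(* [u - C' x^(e+1)] increases and [u + C' x^(e+1)] decreases, so the supremum of
   the former is at distance at most [C' x^(e+1)] from [u]. *)
Lemma bigo_sum_ltN1 e u : e < -1 -> bigo e (fun n => u n.+1 - u n) ->
  exists c, bigo (e + 1) (fun n => u n - c).
Proof.
move=> e1 /bigo_ge0[C C0 hC].
have [|K K0 hK] := @pow_le_diff e; first by rewrite lt_eqF.
pose T n := C * K * xn n `^ (e + 1).
have step n : `|u n.+1 - u n| <= T n - T n.+1.
  rewrite (le_trans (hC n)) // /T -mulrBr -mulrA ler_wpM2l // (le_trans (hK n)) //.
  by rewrite ltr0_sg ?mulN1r ?opprB //; lra.
have T0 n : 0 <= T n by rewrite /T !mulr_ge0 // ltW.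
have lo n m : u n - T n <= u (n + m)%N - T (n + m)%N.
  elim: m => [|m ih]; first by rewrite addn0.
  rewrite addnS (le_trans ih) //; have := step (n + m)%N; rewrite ler_norml; lra.
have hi n m : u (n + m)%N + T (n + m)%N <= u n + T n.
  elim: m => [|m ih]; first by rewrite addn0.
  rewrite addnS (le_trans _ ih) //; have := step (n + m)%N; rewrite ler_norml; lra.
have cross n m : u n - T n <= u m + T m.
  case: (leqP n m) => nm.
    rewrite -(subnKC nm) (le_trans (lo _ (m - n)%N)) //.
    by have := T0 (n + (m - n))%N; lra.
  rewrite -(subnKC (ltnW nm)) (le_trans _ (hi _ (n - m)%N)) //.
  by have := T0 (m + (n - m))%N; lra.
pose S := [set y | exists n, y = u n - T n].
have ubS m : ubound S (u m + T m) by move=> _ [n ->]; exact: cross.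
exists (sup S), (C * K) => n; rewrite ler_distl; apply/andP; split.
  have : sup S <= u n + T n by apply: ge_sup => //; exists (u 0%N - T 0%N), 0%N.
  by rewrite /T; lra.
have : u n - T n <= sup S.
  by apply: ub_le_sup; [exists (u 0%N + T 0%N)|exists n].
by rewrite /T; lra.
Qed.

End BigO.
Arguments tau {R} b k n.

(** * Taylor expansions of the exponential and the logarithm *)

Section Taylor.
Variable R : realType.
Implicit Types (f g : R -> R) (a b : nat -> R).

(** The fixed radius [1/2] keeps [1 + y] away from 0, as the expansion of the logarithm requires. *)
Definition taylor_at m f a := exists C : R, forall y : R, `|y| <= 2^-1 ->
  `|f y - \sum_(i < m) a i * y ^+ i| <= C * `|y| ^+ m.

Lemma MVT0_bound (f g : R -> R) (C : R) m :
  (forall y : R, `|y| <= 2^-1 -> is_derive y (1 : R) f (g y)) ->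
  (forall y : R, `|y| <= 2^-1 -> `|g y| <= C * `|y| ^+ m) ->
  forall y : R, `|y| <= 2^-1 -> `|f y - f 0| <= C * `|y| ^+ m.+1.
Proof.
move=> fg gC y hy.
have C0 : 0 <= C * `|y| ^+ m by apply: le_trans (gC y hy).
have key z : `|z| <= `|y| -> `|g z| * `|y| <= C * `|y| ^+ m.+1.
  move=> zy; rewrite exprSr mulrA ler_wpM2r //.
  apply: le_trans (gC z (le_trans zy hy)) _.
  (* [C] has no assumed sign: if it is negative, [C0] forces [|y| ^+ m = 0], and both sides
     vanish. *)
  have [C0'|C0'] := leP 0 C; first by rewrite ler_wpM2l // lerXn2r ?nnegrE.
  have y0 : `|y| ^+ m = 0.
    apply/eqP; rewrite eq_le exprn_ge0 // andbT leNgt; apply/negP => p.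
    by move: C0; rewrite leNgt nmulr_rlt0 // p.
  have : `|z| ^+ m <= `|y| ^+ m by rewrite lerXn2r ?nnegrE.
  rewrite y0 => zm; have -> : `|z| ^+ m = 0 by apply/eqP; rewrite eq_le zm exprn_ge0.
  by rewrite mulr0.
have cont p q : -2^-1 <= p -> q <= 2^-1 -> {within `[p, q], continuous f}.
  move=> hp hq; apply: derivable_within_continuous => z; rewrite in_itv /= => /andP[h1 h2].
  have := fg z; case; first by rewrite ler_norml; apply/andP; split; lra.
  by [].
move: (hy); rewrite ler_norml => /andP[ly uy].
have [y0|y0] := leP 0 y.
  have [//|z||z] := @MVT_segment R f g 0 y.
  - rewrite in_itv /= => /andP[h1 h2]; apply: fg.
    by rewrite ler_norml; apply/andP; split; lra.
  - by apply: cont; lra.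
  rewrite in_itv /= subr0 => /andP[h1 h2] ->; rewrite normrM; apply: key.
  by rewrite !ger0_norm.
have [|z||z] := @MVT_segment R f g y 0.
- exact: ltW.
- rewrite in_itv /= => /andP[h1 h2]; apply: fg.
  by rewrite ler_norml; apply/andP; split; lra.
- by apply: cont; lra.
rewrite in_itv /= sub0r => /andP[h1 h2] h; rewrite distrC h normrM normrN.
by apply: key; rewrite !ler0_norm //; [rewrite lerN2|exact: ltW].
Qed.

(** Taylor expansions are integrated term by term, by the mean value theorem applied to the
    remainder. Both expansions below come from this. *)
Lemma taylor_prim m f g a b :
  (forall y : R, `|y| <= 2^-1 -> is_derive y (1 : R) f (g y)) ->
  a 0%N = f 0 -> (forall i, b i = i.+1%:R * a i.+1) ->
  taylor_at m g b -> taylor_at m.+1 f a.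
Proof.
move=> fg a0 ba [C hC]; exists C => y hy.
pose p := \poly_(i < m.+1) a i.
have dp : p^`() = \poly_(i < m) b i.
  apply/polyP => i; rewrite coef_deriv !coef_poly ltnS ba.
  by case: ifP => _; rewrite ?mul0rn // mulr_natl.
pose F y := f y - p.[y].
have FG z : `|z| <= 2^-1 -> is_derive z (1 : R) F (g z - p^`().[z]).
  by move=> hz; apply: is_deriveB; exact: fg.
have F0 : F 0 = 0.
  rewrite /F horner_poly big_ord_recl expr0 mulr1 a0 big1 ?addr0 ?subrr // => i _.
  by rewrite expr0n mulr0.
have := @MVT0_bound F (fun z => g z - p^`().[z]) C m FG _ y hy.
rewrite F0 subr0 {1}/F horner_poly; apply => z hz.
by rewrite dp horner_poly; exact: hC.
Qed.

Lemma taylor_expR m : taylor_at m expR (fun i => i`!%:R^-1 : R).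
Proof.
elim: m => [|m ih].
  exists (expR 2^-1) => y hy; rewrite big_ord0 subr0 expr0 mulr1.
  by rewrite ger0_norm ?expR_ge0 // ler_expR (le_trans (ler_norm _)).
apply: taylor_prim ih => // [|i]; first by rewrite expR0 fact0 invr1.
by rewrite factS natrM invfM mulrA divff ?mul1r // pnatr_eq0.
Qed.

Lemma taylor_ln1D m :
  taylor_at m (fun y => ln (1 + y)) (fun i => if i is 0%N then 0 else (-1) ^+ i.-1 / i%:R).
Proof.
(* Positive orders come from integrating the geometric series of [1 / (1 + y)]; order 0 follows from
   order 1 because [|y| <= 1/2]. *)
suff H n : taylor_at n.+1 (fun y => ln (1 + y) : R)
    (fun i => if i is 0%N then 0 else (-1) ^+ i.-1 / i%:R).
  case: m => [|m]; last exact: H.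
  have [C hC] := H 0%N; exists C => y hy; rewrite big_ord0 subr0.
  have := hC y hy; rewrite big_ord1 /= mul0r subr0 expr0 expr1 => h.
  apply: (le_trans h); have C0 : 0 <= C * `|y| by exact: le_trans h.
  have [C1|C1] := leP 0 C; first by rewrite ler_wpM2l //; lra.
  move: h; rewrite mulr1.
  have := hC (2^-1); rewrite ger0_norm // => /(_ (lexx _)); rewrite big_ord1 /= mul0r subr0 expr1.
  move=> /(le_trans (normr_ge0 _)); rewrite pmulr_lge0 //; lra.
apply: (@taylor_prim _ _ (fun y => (1 + y)^-1) _ (fun i => (-1) ^+ i)).
- move=> y; rewrite ler_norml => /andP[h1 h2].
  have h : 0 < 1 + y by lra.
  have := @is_derive1_comp R (@ln R) (fun y => 1 + y) y (1 + y)^-1 1.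
  rewrite mulr1; apply; first exact: is_derive1_ln.
  by rewrite -[X in is_derive _ _ _ X]add0r; apply: is_deriveD.
- by rewrite addr0 ln1.
- by move=> i /=; rewrite mulrC divfK // pnatr_eq0.
exists 2 => y hy; move: (hy); rewrite ler_norml => /andP[h1 h2].
have h : 0 < 1 + y by lra.
have -> : \sum_(i < n) (-1) ^+ i * y ^+ i = (1 - (-y) ^+ n) / (1 + y).
  apply: (mulIf (lt0r_neq0 h)); rewrite divfK ?gt_eqF // mulr_suml.
  elim: n => [|k ih]; first by rewrite big_ord0 expr0 subrr.
  by rewrite big_ord_recr /= ih -exprMn mulN1r exprSr; ring.
have -> : (1 + y)^-1 - (1 - (- y) ^+ n) / (1 + y) = (- y) ^+ n / (1 + y).
  by field; rewrite gt_eqF.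
rewrite normrM normrX normrN mulrC ler_wpM2r ?exprn_ge0 //.
rewrite gtr0_norm ?invr_gt0 // -[leRHS]invrK lef_pV2 ?posrE //; lra.
Qed.

End Taylor.

(** * Finite expansions to arbitrary order *)

Section Expands.
Variable R : realType.
Implicit Types (e b c C g B : R) (u v w : nat -> R) (l : seq (R * R * nat)).

Local Notation xn n := (n.+1%:R : R).
Hint Resolve xn_gt0 xn_ge1 xn_neq0 pow_xn_gt0 : core.

Definition lsum l n : R := \sum_(q <- l) q.1.1 * tau q.1.2 q.2 n.

(** [g] is only an upper bound for the exponents, and the lists for different [B] are chosen
    independently; uniqueness of coefficients reconciles them at the end. *)
Definition expands g u := forall B, exists2 l, all (fun q => q.1.2 <= g) l &
  bigo (- B) (fun n => u n - lsum l n).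

Lemma lsum_cat l1 l2 n : lsum (l1 ++ l2) n = lsum l1 n + lsum l2 n.
Proof. by rewrite /lsum big_cat. Qed.

Lemma lsum_scale c l n :
  lsum [seq (c * q.1.1, q.1.2, q.2) | q <- l] n = c * lsum l n.
Proof. by rewrite /lsum big_map mulr_sumr; apply: eq_bigr => q _; rewrite mulrA. Qed.

Lemma lsum_mul l1 l2 n :
  lsum [seq (q.1.1 * p.1.1, q.1.2 + p.1.2, (q.2 + p.2)%N) | q <- l1, p <- l2] n =
  lsum l1 n * lsum l2 n.
Proof.
rewrite /lsum big_allpairs_dep /= mulr_suml; apply: eq_bigr => q _.
rewrite mulr_sumr; apply: eq_bigr => p _; rewrite -tauM; ring.
Qed.

Lemma lsum_bigo g e l : all (fun q => q.1.2 <= g) l -> g < e -> bigo e (lsum l).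
Proof.
move=> hl ge; elim: l hl => [_|q l ih /= /andP[hq hl]].
  by apply: bigo_ext (bigo0 _) => n; rewrite /lsum big_nil.
apply: bigo_ext (bigoD (bigoZ q.1.1 (@bigo_tau R e q.1.2 q.2 _)) (ih hl)) => [n|].
  by rewrite /lsum big_cons.
exact: le_lt_trans ge.
Qed.

Lemma expands_ext g u v : u =1 v -> expands g u -> expands g v.
Proof. by move=> /funext ->. Qed.

Lemma expands_le g1 g2 u : g1 <= g2 -> expands g1 u -> expands g2 u.
Proof.
move=> h hu B; have [l hl hb] := hu B; exists l => //.
by apply: sub_all hl => q /= /le_trans; apply.
Qed.

Lemma expands_bigo g e u : g < e -> expands g u -> bigo e u.
Proof.
move=> ge hu; have [l hl hb] := hu (- e).
apply: bigo_ext (bigoD _ (lsum_bigo hl ge)) => [n|]; last by rewrite -[e]opprK; apply: hb.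
by rewrite /= subrK.
Qed.

(** Lets an expansion be checked at one precision at a time, with approximants that vary with
    [B]. *)
Lemma expands_approx g u :
  (forall B, exists2 v, expands g v & bigo (- B) (fun n => u n - v n)) -> expands g u.
Proof.
move=> h B; have [v hv hb] := h B; have [l hl hb'] := hv B; exists l => //.
by apply: bigo_ext (bigoD hb hb') => n; ring.
Qed.

Lemma expands_lsum g l : all (fun q => q.1.2 <= g) l -> expands g (lsum l).
Proof. by move=> hl B; exists l => //; apply: bigo_ext (bigo0 _) => n; rewrite subrr. Qed.

Lemma expands_tau g b k : b <= g -> expands g (tau b k).
Proof.
move=> h; apply: expands_ext (@expands_lsum g [:: (1, b, k)] _) => [n|/=].
  by rewrite /lsum big_seq1 mul1r.
by rewrite h.
Qed.

Lemma expands_fast g u : (forall B, bigo (- B) u) -> expands g u.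
Proof.
move=> h B; exists [::] => //; apply: bigo_ext (h B) => n.
by rewrite /lsum big_nil subr0.
Qed.

Lemma expands0 g : expands g (fun=> 0).
Proof. by apply: expands_fast => B; apply: bigo0. Qed.

Lemma expandsD g u v : expands g u -> expands g v -> expands g (fun n => u n + v n).
Proof.
move=> hu hv B; have [l hl hb] := hu B; have [l' hl' hb'] := hv B.
exists (l ++ l'); first by rewrite all_cat hl.
by apply: bigo_ext (bigoD hb hb') => n; rewrite lsum_cat; ring.
Qed.

Lemma expandsM g1 g2 u v : expands g1 u -> expands g2 v ->
  expands (g1 + g2) (fun n => u n * v n).
Proof.
move=> hu hv B.
(* Each remainder gets multiplied by a factor of order at most [g2 + 1] or [g1 + 1], where the extra
   1 absorbs logarithms; the precisions compensate for it. *)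
have [l hl hb] := hu (B + g2 + 1); have [l' hl' hb'] := hv (B + g1 + 1).
exists [seq (q.1.1 * p.1.1, q.1.2 + p.1.2, (q.2 + p.2)%N) | q <- l, p <- l'].
  apply/allP => _ /allpairsPdep[q [p [hq hp ->]]] /=.
  by apply: lerD; [exact: (allP hl)|exact: (allP hl')].
have bv : bigo (g2 + 1) v by apply: expands_bigo hv; lra.
have bl : bigo (g1 + 1) (lsum l) by apply: lsum_bigo hl _; lra.
have h1 := bigoM hb bv; have h2 := bigoM bl hb'.
have E1 : - (B + g2 + 1) + (g2 + 1) = - B by ring.
have E2 : g1 + 1 + - (B + g1 + 1) = - B by ring.
rewrite E1 in h1; rewrite E2 in h2.
by apply: bigo_ext (bigoD h1 h2) => n; rewrite lsum_mul; ring.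
Qed.

Lemma expands_pow g b : b <= g -> expands g (fun n => xn n `^ b).
Proof.
by move=> h; apply: expands_ext (expands_tau 0 h) => n; rewrite /tau expr0 mulr1.
Qed.

Lemma expands_cst g c : 0 <= g -> expands g (fun=> c).
Proof.
move=> h; apply: expands_ext (@expands_lsum g [:: (c, 0, 0%N)] _) => [n|/=].
  by rewrite /lsum big_seq1 /tau powRr0 expr0 !mulr1.
by rewrite h.
Qed.

Lemma expandsZ g c u : expands g u -> expands g (fun n => c * u n).
Proof.
by move=> h; rewrite -[g]add0r; apply: expandsM => //; apply: expands_cst.
Qed.

Lemma expandsN g u : expands g u -> expands g (fun n => - u n).
Proof.
by move=> h; apply: expands_ext (expandsZ (-1) h) => n; rewrite mulN1r.
Qed.

Lemma expandsB g u v : expands g u -> expands g v -> expands g (fun n => u n - v n).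
Proof. by move=> hu hv; apply: expandsD => //; apply: expandsN. Qed.

Lemma expands_sum g (I : Type) (r : seq I) (P : pred I) (F : I -> nat -> R) :
  (forall i, P i -> expands g (F i)) -> expands g (fun n => \sum_(i <- r | P i) F i n).
Proof.
move=> h; elim: r => [|i r ih].
  by apply: expands_ext (expands0 g) => n; rewrite big_nil.
case hi: (P i); last by apply: expands_ext ih => n; rewrite big_cons hi.
by apply: expands_ext (expandsD (h i hi) ih) => n; rewrite big_cons hi.
Qed.

Lemma expandsX g u k : expands g u -> expands (k%:R * g) (fun n => u n ^+ k).
Proof.
move=> h; elim: k => [|k ih].
  by rewrite mul0r; apply: expands_ext (expands_cst 1 (lexx 0)) => n; rewrite expr0.
have -> : k.+1%:R * g = g + k%:R * g by rewrite -nat1r; ring.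
by apply: expands_ext (expandsM h ih) => n; rewrite exprS.
Qed.

Lemma expands_xnV g c : -1 <= g -> expands g (fun n => c / xn n).
Proof.
move=> h; apply: expands_ext (expandsZ c (expands_pow h)) => n.
by rewrite pow_xnN1.
Qed.

Lemma expands_eventually_eq g u v N :
  (forall n, (N <= n)%N -> u n = v n) -> expands g u -> expands g v.
Proof.
move=> h hu; apply: expands_approx => B; exists u => //.
by apply: (@bigo_eventually_eq _ _ (fun=> 0) _ N) (bigo0 _) => n /h ->; rewrite subrr.
Qed.

Lemma bigo_small e u (d : R) : e < 0 -> 0 < d -> bigo e u ->
  exists N, forall n, (N <= n)%N -> `|u n| <= d.
Proof.
move=> e0 d0 /bigo_ge0[C C0 hC].
(* The threshold solves [C x^e = d]. *)
exists (Num.truncn ((C / d) `^ (- e)^-1)).+1 => n hn.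
apply: (le_trans (hC n)).
have h : (C / d) `^ (- e)^-1 <= xn n.
  by apply/ltW/(lt_trans (truncnS_gt _)); rewrite ltr_nat ltnS.
have : ((C / d) `^ (- e)^-1) `^ (- e) <= xn n `^ (- e).
  by apply: ge0_ler_powR; rewrite ?nnegrE ?powR_ge0 ?oppr_ge0 ?(ltW e0).
rewrite -powRrM mulVf ?powRr1 ?divr_ge0 ?(ltW d0) ?lt0r_neq0 //; last by lra.
rewrite ler_pdivrMr // => h'.
have -> : d = d * (xn n `^ (- e) * xn n `^ e).
  by rewrite -pow_xnD addNr powRr0 mulr1.
by rewrite mulrA ler_wpM2r ?powR_ge0 // mulrC.
Qed.

(** The Taylor terms of degree at least [m] in [u] have exponents at most [-m]; finitely many of
    them suffice for each precision. *)
Lemma expands_taylor (f : R -> R) (a : nat -> R) u m :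
  (forall k, taylor_at k f a) -> expands (-1) u ->
  expands (- m%:R) (fun n => f (u n) - \sum_(i < m) a i * u n ^+ i).
Proof.
move=> hf hu; apply: expands_approx => B.
(* Because of logarithms only [u = O(n^(-1/2))] is used, so that [u^M = O(n^-B)] requires
   [M >= 2B]. *)
pose M := (m + (Num.truncn (2 * B)%R).+1)%N.
exists (fun n => \sum_(m <= i < M) a i * u n ^+ i).
  apply: (@expands_ext _ (fun n => \sum_(i <- index_iota m M | (m <= i)%N) a i * u n ^+ i)).
    move=> n; rewrite [RHS]big_seq_cond [LHS]big_seq_cond; apply: eq_bigl => i.
    by rewrite mem_index_iota andbT; case: (m <= i)%N; rewrite ?andbT.
  apply: expands_sum => i mi; apply: expandsZ; apply: expands_le (expandsX i hu).
  by rewrite mulrN1 lerN2 ler_nat.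
have bu : bigo (- 2^-1) u by apply: expands_bigo hu; lra.
have [|//|N hN] := @bigo_small (- 2^-1) u 2^-1 _ _ bu; first by lra.
have [C hC] := hf M.
have [D D0 hD] := bigo_ge0 bu.
apply: (@bigo_eventually _ _ _ (`|C| * D ^+ M) N) => n hn.
have -> : f (u n) - \sum_(i < m) a i * u n ^+ i - \sum_(m <= i < M) a i * u n ^+ i =
    f (u n) - \sum_(i < M) a i * u n ^+ i.
  rewrite -!(big_mkord xpredT (fun i => a i * u n ^+ i)) -addrA -opprD -big_cat_nat //.
  by rewrite leq_addr.
apply: (le_trans (hC _ (hN n hn))).
apply: (@le_trans _ _ (`|C| * `|u n| ^+ M)).
  by rewrite ler_wpM2r ?exprn_ge0 ?ler_norm.
rewrite -mulrA ler_wpM2l //.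
apply: (@le_trans _ _ ((D * xn n `^ (- 2^-1)) ^+ M)).
  by rewrite lerXn2r ?nnegrE ?mulr_ge0 ?powR_ge0.
rewrite exprMn ler_wpM2l ?exprn_ge0 // -powR_mulrn ?powR_ge0 // -powRrM.
apply: pow_xn_le; rewrite mulNr lerN2 mulrC ler_pdivlMr // mulrC.
apply/ltW/(lt_le_trans (truncnS_gt _)); by rewrite ler_nat leq_addl.
Qed.

Lemma expands_expR1 u : expands (-1) u -> expands (-2) (fun n => expR (u n) - 1 - u n).
Proof.
move=> hu; apply: expands_ext (@expands_taylor _ _ u 2 (@taylor_expR R) hu) => n.
rewrite big_ord_recl big_ord1 lift0 factS fact0 muln1 invr1 !mul1r expr0.
by rewrite opprD addrA.
Qed.

Lemma expands_expR u : expands (-1) u -> expands 0 (fun n => expR (u n)).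
Proof.
move=> hu; have h := expands_expR1 hu.
apply: (@expands_ext _ (fun n => (expR (u n) - 1 - u n) + (1 + u n))) => [n|]; first by ring.
apply: expandsD; first by apply: expands_le h; lra.
by apply: expandsD; [exact: expands_cst|apply: expands_le hu; lra].
Qed.

(* [A = a + a'] up to terms two orders below the leading one. *)
Definition jet g (A a a' : nat -> R) :=
  [/\ expands g a, expands (g - 1) a' & expands (g - 2) (fun n => A n - a n - a' n)].

Lemma jet_expands g A a a' : jet g A a a' -> expands g A.
Proof.
case=> h0 h1 h2; apply: (@expands_ext _ (fun n => (A n - a n - a' n) + (a n + a' n))).
  by move=> n; ring.
by apply: expandsD; [|apply: expandsD => //]; [apply: expands_le h2|apply: expands_le h1]; lra.
Qed.

Lemma jet_diff g A a a' : jet g A a a' -> expands (g - 1) (fun n => A n - a n).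
Proof.
case=> h0 h1 h2; apply: (@expands_ext _ (fun n => (A n - a n - a' n) + a' n)).
  by move=> n; ring.
by apply: expandsD => //; apply: expands_le h2; lra.
Qed.

Lemma jetM g1 g2 A a a' D d d' : jet g1 A a a' -> jet g2 D d d' ->
  jet (g1 + g2) (fun n => A n * D n) (fun n => a n * d n)
    (fun n => a' n * d n + a n * d' n).
Proof.
move=> jA jD; have hA := jet_diff jA; have hD := jet_diff jD.
case: jA => h0 h1 h2; case: jD => k0 k1 k2.
have E1 : g1 + g2 - 1 = g1 - 1 + g2 by ring.
have E2 : g1 + g2 - 1 = g1 + (g2 - 1) by ring.
split; first exact: expandsM.
  apply: expandsD; first by rewrite E1; apply: expandsM.
  by rewrite E2; apply: expandsM.
apply: (@expands_ext _ (fun n => ((A n - a n - a' n) * d n + a n * (D n - d n - d' n))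
   + (A n - a n) * (D n - d n))); first by move=> n; ring.
apply: expandsD; first apply: expandsD.
- have -> : g1 + g2 - 2 = g1 - 2 + g2 by ring.
  exact: expandsM.
- have -> : g1 + g2 - 2 = g1 + (g2 - 2) by ring.
  exact: expandsM.
- have -> : g1 + g2 - 2 = g1 - 1 + (g2 - 1) by ring.
  exact: expandsM.
Qed.

Lemma expands_ln1D c m : expands (- m%:R)
  (fun n => ln (1 + c / xn n) -
    \sum_(i < m) (if i : nat is 0%N then 0 else (-1) ^+ i.-1 / i%:R) * (c / xn n) ^+ i).
Proof.
exact: (expands_taylor m (@taylor_ln1D R) (expands_xnV c (lexx _))).
Qed.

Lemma expands_ln1D1 c : expands (-2) (fun n => ln (1 + c / xn n) - c / xn n).
Proof.
apply: expands_ext (expands_ln1D c 2) => n.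
by rewrite !big_ord_recl big_ord0 /= /bump /= mul0r add0r expr0 invr1 !mul1r addr0 expr1.
Qed.

Lemma expands_ln1D0 c : expands (-1) (fun n => ln (1 + c / xn n)).
Proof.
apply: (@expands_ext _ (fun n => (ln (1 + c / xn n) - c / xn n) + c / xn n)).
  by move=> n; ring.
by apply: expandsD; [apply: expands_le (expands_ln1D1 c); lra|exact: expands_xnV].
Qed.

Lemma xn_eventually_gt c : exists N, forall n, (N <= n)%N -> 0 < xn n + c.
Proof.
exists (Num.truncn (- c)).+1 => n hn.
have : - c < xn n by apply: (lt_trans (truncnS_gt _)); rewrite ltr_nat ltnS.
by lra.
Qed.

Lemma xn_shiftE n c : xn n + c = xn n * (1 + c / xn n).
Proof. by rewrite mulrDr mulr1 mulrCA divff // mulr1. Qed.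

Lemma expands_lnX k : expands 0 (fun n => ln (xn n) ^+ k).
Proof.
by apply: expands_ext (expands_tau k (lexx 0)) => n; rewrite /tau powRr0 mul1r.
Qed.

Lemma jet_ln c : jet 0 (fun n => ln (xn n + c)) (fun n => ln (xn n)) (fun n => c / xn n).
Proof.
split; first exact: (expands_lnX 1).
  by apply: expands_xnV; lra.
rewrite sub0r; have [N hN] := xn_eventually_gt c.
apply: (expands_eventually_eq (N := N)) (expands_ln1D1 c) => n /hN h.
have h' : 0 < 1 + c / xn n by move: h; rewrite xn_shiftE pmulr_rgt0.
by rewrite xn_shiftE lnM ?posrE //; ring.
Qed.

Lemma jet_lnX c k : jet 0 (fun n => ln (xn n + c) ^+ k) (fun n => ln (xn n) ^+ k)
  (fun n => c * (k%:R * (ln (xn n) ^+ k.-1 / xn n))).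
Proof.
elim: k => [|k ih].
  split; first exact: (expands_lnX 0).
    by apply: expands_ext (expands0 _) => n; rewrite mul0r mulr0.
  by apply: expands_ext (expands0 _) => n; rewrite mul0r mulr0 !expr0 subrr subr0.
have := jetM (jet_ln c) ih; rewrite addr0.
under eq_fun do rewrite -exprS; under [X in jet _ _ X]eq_fun do rewrite -exprS.
congr jet; apply/funext => n /=; rewrite -[k.+1%:R]nat1r.
by case: k {ih} => [|k] /=; rewrite ?exprS; ring.
Qed.

(** [(x + c)^b = x^b exp (b ln (1 + c/x))], where the exponential and the logarithm are expanded
    with errors of order [-2]. *)
Lemma jet_pow c b : jet b (fun n => (xn n + c) `^ b) (fun n => xn n `^ b)
  (fun n => c * (b * xn n `^ (b - 1))).
Proof.
split; first exact: expands_pow.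
  by do 2 apply: expandsZ; exact: expands_pow.
have [N hN] := xn_eventually_gt c.
have h1 : expands (-1) (fun n => b * ln (1 + c / xn n)).
  exact: expandsZ (expands_ln1D0 c).
have h2 := expandsD (expands_expR1 h1) (expandsZ b (expands_ln1D1 c)).
have h3 := expandsM (@expands_pow b b (lexx _)) h2.
apply: (expands_eventually_eq (N := N)) h3 => n /hN h.
have h' : 0 < 1 + c / xn n by move: h; rewrite xn_shiftE pmulr_rgt0.
rewrite xn_shiftE powRM ?(ltW h') // [X in _ = _ * X - _ - _]/powR gt_eqF //.
rewrite pow_xnD pow_xnN1; field; by rewrite nat1r.
Qed.

(** The correction is [c] times the derivative of [x^b ln^k x]. *)
Lemma jet_tau c b k : jet b (fun n => (xn n + c) `^ b * ln (xn n + c) ^+ k) (tau b k)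
  (fun n => c * (b * tau (b - 1) k n + k%:R * tau (b - 1) k.-1 n)).
Proof.
have := jetM (jet_pow c b) (jet_lnX c k); rewrite addr0.
congr jet; apply/funext => n /=.
by rewrite /tau pow_xnD pow_xnN1; ring.
Qed.

(** By linearity only the elementary terms [tau b k] have to be treated; the bound on [Op] takes
    care of the remainders. *)
Lemma expands_linear (Op : (nat -> R) -> nat -> R) g g' :
  (forall e u, bigo e u -> bigo e (Op u)) ->
  (forall c u v n, Op (fun n => c * u n + v n) n = c * Op u n + Op v n) ->
  (forall b k, b <= g -> expands g' (Op (tau b k))) ->
  forall u, expands g u -> expands g' (Op u).
Proof.
move=> hO hL hT u hu; apply: expands_approx => B; have [l hl hb] := hu B.
exists (Op (lsum l)); last first.
  apply: bigo_ext (hO _ _ hb) => n.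
  have -> : (fun n => u n - lsum l n) = (fun n => -1 * lsum l n + u n).
    by apply/funext => k; ring.
  by rewrite hL; ring.
elim: l hl {hb} => [_|q l ih /= /andP[hq hl]].
  apply: expands_ext (expands0 _) => n.
  have -> : lsum [::] = (fun n => -1 * (fun=> 0) n + (fun=> 0) n).
    by apply/funext => k; rewrite /lsum big_nil; ring.
  by rewrite hL; ring.
have -> : lsum (q :: l) = (fun n => q.1.1 * tau q.1.2 q.2 n + lsum l n).
  by apply/funext => k; rewrite /lsum big_cons.
apply: expands_ext (expandsD (expandsZ q.1.1 (hT _ q.2 hq)) (ih hl)) => n.
by rewrite hL.
Qed.

Lemma expands_shift g u : expands g u -> expands g (fun n => u n.+1).
Proof.
apply: (@expands_linear (fun u n => u n.+1)) => // [|b k bg]; first exact: bigo_shift.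
apply: expands_le bg _; apply: expands_ext (jet_expands (jet_tau 1 b k)) => n.
by rewrite /tau natr1.
Qed.

Lemma xn_pred n : (0 < n)%N -> xn n - 1 = xn n.-1.
Proof. by case: n => // n _; rewrite -[n.+2%:R]natr1 addrK. Qed.

Lemma expands_pred g u : expands g u -> expands g (fun n => u n.-1).
Proof.
apply: (@expands_linear (fun u n => u n.-1)) => // [e v hv|b k bg].
  exact: bigo_unshift.
apply: expands_le bg _.
apply: (expands_eventually_eq (N := 1)) (jet_expands (jet_tau (-1) b k)) => n hn.
by rewrite /tau xn_pred.
Qed.

Lemma expands_unshift g u : expands g (fun n => u n.+1) -> expands g u.
Proof.
by move=> /expands_pred; apply: (expands_eventually_eq (N := 1)) => -[].
Qed.

Lemma expands_bdiff g u : expands g u -> expands (g - 1) (fun n => u n - u n.-1).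
Proof.
apply: (@expands_linear (fun u n => u n - u n.-1)) => [e v hv|c v w n|b k bg].
- by apply: bigoB => //; apply: bigo_unshift.
- ring.
apply: (@expands_le (b - 1)); first by lra.
have := expandsN (jet_diff (jet_tau (-1) b k)).
apply: (expands_eventually_eq (N := 1)) => n hn.
by rewrite /tau xn_pred //; ring.
Qed.

Lemma expands_fdiff_tau b k : expands (b - 2) (fun n => tau b k n.+1 - tau b k n -
  (b * tau (b - 1) k n + k%:R * tau (b - 1) k.-1 n)).
Proof.
have [_ _ h] := jet_tau 1 b k; apply: expands_ext h => n.
by rewrite mul1r /tau natr1.
Qed.

End Expands.

(** * Antidifferences and first-order recurrences *)

Section Antidifference.
Variable R : realType.
Implicit Types (e b c C g B : R) (u v w x y : nat -> R) (l : seq (R * R * nat)).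

Local Notation xn n := (n.+1%:R : R).
Hint Resolve xn_gt0 xn_ge1 xn_neq0 pow_xn_gt0 : core.

(** Discrete integration of [x^b ln^k x]: by parts, with induction on [k], when [b != -1]; for
    [b = -1] the power of the logarithm increases instead. The error is one order below the given
    term. *)
Lemma antidiff_tau b k : exists2 X, expands (b + 1) X &
  expands (b - 1) (fun n => X n.+1 - X n - tau b k n).
Proof.
have [->|b1] := eqVneq b (-1).
  rewrite addNr; exists (fun n => k.+1%:R^-1 * tau 0 k.+1 n).
    by apply: expandsZ; apply: expands_tau.
  have -> : -1 - 1 = 0 - 2 :> R by ring.
  apply: expands_ext (expandsZ k.+1%:R^-1 (expands_fdiff_tau 0 k.+1)) => n.
  by rewrite sub0r; field; rewrite nat1r.
have b1' : b + 1 != 0 by rewrite addr_eq0.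
elim: k => [|k [X hX hX']].
  exists (fun n => (b + 1)^-1 * tau (b + 1) 0 n).
    by apply: expandsZ; apply: expands_tau.
  have -> : b - 1 = b + 1 - 2 by ring.
  apply: expands_ext (expandsZ (b + 1)^-1 (expands_fdiff_tau (b + 1) 0)) => n.
  by rewrite mul0r addrK; field.
exists (fun n => (b + 1)^-1 * (tau (b + 1) k.+1 n - k.+1%:R * X n)).
  by apply: expandsZ; apply: expandsB; [exact: expands_tau|exact: expandsZ].
have h := expands_fdiff_tau (b + 1) k.+1.
have E : b + 1 - 2 = b - 1 by ring.
rewrite E in h.
apply: expands_ext (expandsZ (b + 1)^-1 (expandsB h (expandsZ k.+1%:R hX'))) => n.
by rewrite addrK /=; field.
Qed.

Lemma antidiff_lsum g l : all (fun q => q.1.2 <= g) l -> exists2 X, expands (g + 1) X &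
  expands (g - 1) (fun n => X n.+1 - X n - lsum l n).
Proof.
elim: l => [_|q l ih /= /andP[hq /ih[X hX hX']]].
  exists (fun=> 0); first exact: expands0.
  by apply: expands_ext (expands0 _) => n; rewrite /lsum big_nil; ring.
have [Y hY hY'] := antidiff_tau q.1.2 q.2.
exists (fun n => q.1.1 * Y n + X n).
  by apply: expandsD => //; apply: expandsZ; apply: expands_le hY; lra.
have h : expands (g - 1) (fun n => Y n.+1 - Y n - tau q.1.2 q.2 n).
  by apply: expands_le hY'; lra.
apply: expands_ext (expandsD (expandsZ q.1.1 h) hX') => n.
by rewrite /lsum big_cons; ring.
Qed.

(** The error left by [antidiff_lsum] is one order lower; it is integrated in turn until its order
    falls below [-B]. *)
Lemma antidiff_approx g y B : expands g y -> exists2 X, expands (g + 1) X &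
  bigo (- B) (fun n => X n.+1 - X n - y n).
Proof.
move: (truncnS_gt (g + B + 1)) => /ltW; move: (Num.truncn _).+1 => N.
elim: N g y => [|N ih] g y hN hy.
  exists (fun=> 0); first exact: expands0.
  have h : bigo (- B) y by apply: expands_bigo hy; lra.
  by apply: bigo_ext (bigoN h) => n; ring.
have [l hl hb] := hy B; have [X hX hX'] := antidiff_lsum hl.
have hN' : g - 1 + B + 1 <= N%:R by move: hN; rewrite -nat1r; lra.
have [X' hX1 hX2] := ih _ _ hN' (expandsN hX').
exists (fun n => X n + X' n).
  by apply: expandsD => //; apply: expands_le hX1; lra.
by apply: bigo_ext (bigoB hX2 hb) => n; ring.
Qed.

Lemma bigo_cst_eq0 e c : e < 0 -> bigo e (fun=> c) -> c = 0.
Proof.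
move=> e0 h; apply/eqP; rewrite -normr_le0; apply/ler_addgt0Pl => d d0.
by have [N /(_ N (leqnn _))] := bigo_small e0 d0 h; rewrite addr0.
Qed.

(** The [0] in the maximum is the exponent of the constant of summation. *)
Lemma expands_antidiff g x : expands g (fun n => x n.+1 - x n) ->
  expands (Num.max (g + 1) 0) x.
Proof.
move=> h; apply: expands_approx => B.
(* The exponent [-(|B| + 2)] is below [-1], so the error is summable, with tails of order
   [-|B| - 1]. *)
have [X hX hb] := antidiff_approx (`|B| + 2) h.
have [||c hc] := @bigo_sum_ltN1 R (- (`|B| + 2)) (fun n => x n - X n).
- by have := normr_ge0 B; lra.
- by apply: bigo_ext (bigoN hb) => n; ring.
exists (fun n => X n + c).
  apply: expandsD; first by apply: expands_le hX; rewrite le_max lexx.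
  by apply: expands_cst; rewrite le_max lexx orbT.
apply: bigo_ext (bigo_le _ hc) => [n|]; first by ring.
by have := ler_norm B; lra.
Qed.

Lemma expands_antidiff_ltN1 g x : g < -1 -> expands g (fun n => x n.+1 - x n) ->
  exists c, expands (g + 1) (fun n => x n - c).
Proof.
(* [e] lies strictly between [g] and [-1], to absorb logarithms. *)
move=> g1 h; pose e := (g - 1) / 2.
have [||c hc] := @bigo_sum_ltN1 R e x; first by rewrite /e; lra.
  by apply: expands_bigo h; rewrite /e; lra.
exists c; apply: expands_approx => B.
have [X hX hb] := antidiff_approx (`|B| + 2) h.
have [||c' hc'] := @bigo_sum_ltN1 R (- (`|B| + 2)) (fun n => x n - X n).
- by have := normr_ge0 B; lra.
- by apply: bigo_ext (bigoN hb) => n; ring.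
exists X => //.
have bX : bigo (e + 1) X by apply: expands_bigo hX; rewrite /e; lra.
pose m := Num.max (e + 1) (- (`|B| + 2) + 1).
(* The constant [c'] found at precision [B] is the limit [c] of [x], since [X] tends to 0. *)
have cc : c - c' = 0.
  apply: (@bigo_cst_eq0 m).
    by rewrite gt_max; have := normr_ge0 B; rewrite /e; lra.
  have m1 : e + 1 <= m by rewrite le_max lexx.
  have m2 : - (`|B| + 2) + 1 <= m by rewrite le_max lexx orbT.
  apply: bigo_ext (bigoB (bigoD (bigo_le m2 hc') (bigo_le m1 bX)) (bigo_le m1 hc)) => n.
  by ring.
apply: bigo_ext (bigo_le _ hc') => [n|]; last by have := ler_norm B; lra.
have -> : c' = c by lra.
by ring.
Qed.

(** [L] is [b ln (n+1)] plus a convergent sequence with an expansion; exponentiation gives a power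
    times a constant times an expandable factor. *)
Lemma expands_expR_antidiff b L :
  expands (-2) (fun n => L n.+1 - L n - b / xn n) -> expands b (fun n => expR (L n)).
Proof.
move=> h; have [_ _ h1] := @jet_ln R 1; rewrite sub0r in h1.
have [||c] := @expands_antidiff_ltN1 (-2) (fun n => L n - b * ln (xn n)); first by lra.
  apply: expands_ext (expandsB h (expandsZ b h1)) => n.
  by rewrite natr1; ring.
have -> : -2 + 1 = -1 :> R by ring.
move=> /expands_expR /(expandsZ (expR c)) h2.
rewrite -[b]addr0; apply: expands_ext (expandsM (@expands_pow R b b (lexx _)) h2) => n.
rewrite /powR (negbTE (xn_neq0 _ n)) -!expRD; congr expR; ring.
Qed.

(** A single level of precision. The strict inequality leaves room for the arbitrarily small power
    lost in solving a recurrence. *)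
Definition expands_upto B g u := exists2 v, expands g v &
  exists2 e, e < - B & bigo e (fun n => u n - v n).

Lemma expands_upto_expands g u : (forall B, expands_upto B g u) -> expands g u.
Proof.
move=> h; apply: expands_approx => B; have [v hv [e he hb]] := h B.
by exists v => //; apply: bigo_le hb; apply: ltW.
Qed.

Lemma expands_expands_upto B g u : expands g u -> expands_upto B g u.
Proof.
move=> h; exists u => //; exists (- B - 1); first by lra.
by apply: bigo_ext (bigo0 _) => n; rewrite subrr.
Qed.

Lemma expands_upto_ext B g u v : u =1 v -> expands_upto B g u -> expands_upto B g v.
Proof. by move=> /funext ->. Qed.

Lemma expands_uptoD B g u v : expands_upto B g u -> expands_upto B g v ->
  expands_upto B g (fun n => u n + v n).
Proof.
move=> [u' hu [e he hb]] [v' hv [f hf hb']].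
exists (fun n => u' n + v' n); first exact: expandsD.
exists (Num.max e f); first by rewrite gt_max he.
have m1 : e <= Num.max e f by rewrite le_max lexx.
have m2 : f <= Num.max e f by rewrite le_max lexx orbT.
by apply: bigo_ext (bigoD (bigo_le m1 hb) (bigo_le m2 hb')) => n; ring.
Qed.

Lemma expands_uptoZ B g c u : expands_upto B g u -> expands_upto B g (fun n => c * u n).
Proof.
move=> [v hv [e he hb]]; exists (fun n => c * v n); first exact: expandsZ.
by exists e => //; apply: bigo_ext (bigoZ c hb) => n; ring.
Qed.

(* The homogeneous equation has the solution [h] with [ln h] an antidifference of
   [ln (1 + (a - 1) / x)]; variation of the constant does the rest. *)
Lemma expands_upto_rec a B g w y :
  (forall n, n.+1%:R * w n.+1 = (n%:R + a) * w n + y n) -> a - 1 <= g ->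
  expands_upto B g y -> expands_upto B g w.
Proof.
move=> hw ag [v hv [e he hb]].
pose L n := \sum_(i < n) ln (1 + (a - 1) / xn i).
have dL n : L n.+1 = L n + ln (1 + (a - 1) / xn n) by rewrite /L big_ord_recr.
have hh : expands (a - 1) (fun n => expR (L n)).
  apply: expands_expR_antidiff.
  by apply: expands_ext (expands_ln1D1 (a - 1)) => n; rewrite dL; ring.
have hi : expands (1 - a) (fun n => expR (- L n)).
  apply: expands_expR_antidiff.
  by apply: expands_ext (expandsN (expands_ln1D1 (a - 1))) => n; rewrite dL; ring.
have [N hN] := xn_eventually_gt (a - 1).
(* Increments of [w / h], where [h n = expR (L n)], with [y] replaced by its expandable part [v]. *)
pose z n := expR (- L n.+1) * v n * xn n `^ (-1).
have hz : expands (g - a) z.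
  have -> : g - a = 1 - a + g + -1 by ring.
  apply: expandsM; last exact: expands_pow.
  apply: expandsM => //.
  exact: (@expands_shift R _ (fun n => expR (- L n))).
pose W n := \sum_(i < n) z i.
have hW : expands (Num.max (g - a + 1) 0) W.
  by apply: expands_antidiff; apply: expands_ext hz => n; rewrite /W big_ord_recr /=; ring.
pose V n := w n * expR (- L n) - W n.
(* Below [N] the argument of the logarithm may be nonpositive, and then [expR (L n)] need not
   satisfy the homogeneous recurrence. *)
have hV n : (N <= n)%N -> V n.+1 - V n = expR (- L n.+1) * (y n - v n) * xn n `^ (-1).
  move=> /hN h0; have h1 : 0 < 1 + (a - 1) / xn n by move: h0; rewrite xn_shiftE pmulr_rgt0.
  have E1 : expR (- L n) = expR (- L n.+1) * (1 + (a - 1) / xn n).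
    by rewrite dL opprD expRD -mulrA (expRN (ln _)) lnK ?posrE // mulVf ?mulr1 // gt_eqF.
  have E2 : w n.+1 = ((n%:R + a) * w n + y n) / xn n by rewrite -hw mulrC mulKf.
  rewrite /V /W big_ord_recr /= -/(W n) E1 E2 /z pow_xnN1 -[n.+1%:R]natr1.
  by field; rewrite natr1.
pose d := - B - e; have d0 : 0 < d by rewrite /d; lra.
(* [r] absorbs logarithms twice, which costs [2 * r < d], and avoids the exponent [-1], where
   summation would create a logarithm. *)
have [r [r0 rd hr]] : exists r, [/\ 0 < r, 2 * r < d & e - a + r != -1].
  have [h|h] := eqVneq (e - a + d / 4) (-1).
    by exists (d / 3); split; [lra|lra|apply/eqP; lra].
  by exists (d / 4); split => //; lra.
have bV : bigo (e - a + r) (fun n => V n.+1 - V n).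
  have b1 : bigo (1 - a + r) (fun n => expR (- L n.+1)).
    by apply: (@bigo_shift R _ (fun n => expR (- L n))); apply: expands_bigo hi; lra.
  have -> : e - a + r = 1 - a + r + e + -1 by ring.
  apply: (bigo_eventually_eq (N := N)) (bigoM (bigoM b1 hb) (@bigo_pow R (-1))).
  by move=> n /hV ->.
have [c hc] : exists c, bigo (e - a + r + 1) (fun n => V n - c).
  have [h|h] := ltP (e - a + r) (-1); first exact: bigo_sum_ltN1.
  exists 0; apply: bigo_ext (bigo_sum_gtN1 _ bV) => [n|]; first by rewrite subr0.
  by rewrite lt_neqAle eq_sym hr.
exists (fun n => expR (L n) * (W n + c)).
  have -> : g = a - 1 + (g - a + 1) by ring.
  apply: expandsM => //; apply: expandsD.
    by apply: expands_le hW; rewrite ge_max lexx; lra.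
  by apply: expands_cst; lra.
exists (e + 2 * r); first by rewrite /d in rd; lra.
have bh : bigo (a - 1 + r) (fun n => expR (L n)) by apply: expands_bigo hh; lra.
have -> : e + 2 * r = (a - 1 + r) + (e - a + r + 1) by ring.
apply: bigo_ext (bigoM bh hc) => n; rewrite /V.
have := expRxMexpNx_1 (L n) => h.
rewrite -[X in _ = X - _]mul1r -h; ring.
Qed.

Lemma expands_rec a g w y :
  (forall n, n.+1%:R * w n.+1 = (n%:R + a) * w n + y n) -> a - 1 <= g ->
  expands g y -> expands g w.
Proof.
move=> hw ag hy; apply: expands_upto_expands => B.
by apply: expands_upto_rec hw ag _; apply: expands_expands_upto.
Qed.

End Antidifference.

(** * Convolution *)

(** A separate name lets sequences carry the Cauchy product as their ring structure, instead of the
    pointwise product. *)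
Definition fps (R : realType) := nat -> R.

Section FormalSeries.
Variable R : realType.
Implicit Types u v w : fps R.

HB.instance Definition _ := gen_eqMixin (fps R).
HB.instance Definition _ := gen_choiceMixin (fps R).

Definition fps_add u v : fps R := fun n => u n + v n.
Definition fps_opp u : fps R := fun n => - u n.

Fact fps_addA : associative fps_add.
Proof. by move=> u v w; apply/funext => n; rewrite /fps_add addrA. Qed.
Fact fps_addC : commutative fps_add.
Proof. by move=> u v; apply/funext => n; rewrite /fps_add addrC. Qed.
Fact fps_add0 : left_id (fun=> 0) fps_add.
Proof. by move=> u; apply/funext => n; rewrite /fps_add add0r. Qed.
Fact fps_addN : left_inverse (fun=> 0) fps_opp fps_add.
Proof. by move=> u; apply/funext => n; rewrite /fps_add /fps_opp addNr. Qed.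

HB.instance Definition _ :=
  GRing.isZmodule.Build (fps R) fps_addA fps_addC fps_add0 fps_addN.

Definition conv u v : fps R := fun n => \sum_(i < n.+1) u i * v (n - i)%N.

Lemma coefM_local (p q p' q' : {poly R}) n :
  (forall i, (i <= n)%N -> p`_i = p'`_i) -> (forall i, (i <= n)%N -> q`_i = q'`_i) ->
  (p * q)`_n = (p' * q')`_n.
Proof.
move=> hp hq; rewrite !coefM; apply: eq_bigr => i _.
by rewrite hp ?hq ?leq_subr // -ltnS.
Qed.

Let tr N u := \poly_(i < N) u i.

(** Through truncation to polynomials, associativity and commutativity are inherited from
    [{poly R}]. *)
Lemma convE N u v n : (n < N)%N -> conv u v n = (tr N u * tr N v)`_n.
Proof.
move=> hn; rewrite coefM; apply: eq_bigr => i _; rewrite !coef_poly.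
by rewrite (leq_ltn_trans (leq_subr _ _) hn) (leq_ltn_trans _ hn) // -ltnS.
Qed.

Fact conv_assoc : associative conv.
Proof.
move=> u v w; apply/funext => n; rewrite !(@convE n.+1) //.
have E a b i : (i <= n)%N -> (tr n.+1 (conv a b))`_i = (tr n.+1 a * tr n.+1 b)`_i.
  by move=> hi; rewrite coef_poly ltnS hi (@convE n.+1).
rewrite (@coefM_local _ _ (tr n.+1 u) (tr n.+1 v * tr n.+1 w)) //; last exact: E.
rewrite mulrA; apply: coefM_local => // i hi; by rewrite E.
Qed.

Fact conv_comm : commutative conv.
Proof. by move=> u v; apply/funext => n; rewrite !(@convE n.+1) // mulrC. Qed.

Fact conv1 : left_id (fun n => (n == 0)%:R) conv.
Proof.
move=> u; apply/funext => n; rewrite /conv big_ord_recl mul1r subn0 big1 ?addr0 // => i _.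
by rewrite mul0r.
Qed.

Fact convDl : left_distributive conv fps_add.
Proof.
move=> u v w; apply/funext => n; rewrite /conv /fps_add -big_split.
by apply: eq_bigr => i _; rewrite mulrDl.
Qed.

Fact fps_one_neq0 : (fun n => (n == 0)%:R : R) != (0 : fps R).
Proof. by apply/eqP => /(congr1 (fun f => f 0%N)) /eqP; rewrite oner_eq0. Qed.

HB.instance Definition _ := GRing.Zmodule_isComNzRing.Build (fps R)
  conv_assoc conv_comm conv1 convDl fps_one_neq0.

Lemma fpsDE u v n : (u + v) n = u n + v n. Proof. by []. Qed.
Lemma fpsNE u n : (- u) n = - u n. Proof. by []. Qed.
Lemma fps0E n : (0 : fps R) n = 0. Proof. by []. Qed.
Lemma fps1E n : (1 : fps R) n = (n == 0)%:R. Proof. by []. Qed.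
Lemma fpsME u v n : (u * v) n = \sum_(i < n.+1) u i * v (n - i)%N.
Proof. by []. Qed.

Definition fpsC (c : R) : fps R := fun n => if n is 0%N then c else 0.

Lemma fpsCM c u n : (fpsC c * u) n = c * u n.
Proof.
rewrite fpsME big_ord_recl subn0 big1 ?addr0 // => i _; by rewrite mul0r.
Qed.

Definition fpsX : fps R := fun n => (n == 1%N)%:R.

Lemma fpsXM u n : (fpsX * u) n = if n is m.+1 then u m else 0.
Proof.
rewrite fpsME; case: n => [|n]; first by rewrite big_ord1 mul0r.
rewrite !big_ord_recl big1 ?addr0; last by move=> i _; rewrite mul0r.
by rewrite mul0r add0r mul1r lift0 subSS subn0.
Qed.

(** The derivation [X d/dX]. *)
Definition theta u : fps R := fun n => n%:R * u n.

Lemma thetaM u v : theta (u * v) = theta u * v + u * theta v.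
Proof.
apply/funext => n; rewrite fpsDE /theta !fpsME mulr_sumr -big_split.
apply: eq_bigr => i _ /=; rewrite natrB; [ring|by rewrite -ltnS].
Qed.

Lemma thetaD u v : theta (u + v) = theta u + theta v.
Proof. by apply/funext => n; rewrite /theta !fpsDE mulrDr. Qed.

Lemma thetaN u : theta (- u) = - theta u.
Proof. by apply/funext => n; rewrite /theta !fpsNE mulrN. Qed.

Lemma theta1 : theta 1 = 0.
Proof. by apply/funext => -[|n]; rewrite /theta fps1E ?mul0r ?mulr0. Qed.

(* The derivation [(1 - X) d/dX]. *)
Definition fpsD u : fps R := fun n => n.+1%:R * u n.+1 - n%:R * u n.

Lemma fpsDM u v : fpsD (u * v) = fpsD u * v + u * fpsD v.
Proof.
(* Multiplication by [fpsX] reduces the Leibniz rule to that of [theta], and can be cancelled. *)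
have E w : fpsX * fpsD w = theta w - fpsX * theta w.
  apply/funext => n; rewrite fpsXM fpsDE fpsNE fpsXM /theta.
  by case: n => [|n]; rewrite ?mul0r ?subrr.
have inj w w' : fpsX * w = fpsX * w' -> w = w'.
  by move=> h; apply/funext => n; have := congr1 (fun f => f n.+1) h; rewrite !fpsXM.
by apply: inj; rewrite E mulrDr [fpsX * (u * _)]mulrCA mulrA !E thetaM; ring.
Qed.

(** Substitution of [q X] for [X]; used to bring radii of convergence to 1. *)
Definition dilate (q : R) u : fps R := fun n => q ^+ n * u n.

End FormalSeries.
Arguments fpsX {R}.

(** * Asymptotics of Cauchy products *)

Section Convolution.
Variable R : realType.
Implicit Types (e b c C g p q B G : R) (u v w r : fps R).

Local Notation xn n := (n.+1%:R : R).
Hint Resolve xn_gt0 xn_ge1 xn_neq0 pow_xn_gt0 : core.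

Lemma expands_upto_le B B' g g' u : B' <= B -> g <= g' ->
  expands_upto B g u -> expands_upto B' g' u.
Proof.
move=> hB hg [v hv [e he hb]]; exists v; first exact: expands_le hv.
by exists e => //; lra.
Qed.

Lemma expands_upto_bigo B g u : bigo (- B - 1) u -> expands_upto B g u.
Proof.
move=> h; exists (fun=> 0); first exact: expands0.
by exists (- B - 1); [lra|apply: bigo_ext h => n; rewrite subr0].
Qed.

(* [(i + 1) (n - i + 1) >= n + 1] *)
Lemma bigo_conv (s : R) u v : 0 <= s -> bigo (- s) u -> bigo (- s) v ->
  bigo (1 - s) (u * v).
Proof.
move=> s0 /bigo_ge0[C C0 hC] /bigo_ge0[D D0 hD]; exists (C * D) => n.
rewrite fpsME; apply: (le_trans (ler_norm_sum _ _ _)).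
apply: (@le_trans _ _ (\sum_(i < n.+1) C * D * xn n `^ (- s))); last first.
  by rewrite sumr_const card_ord -[X in X <= _]mulr_natr pow_xnD pow_xn1 -mulrA [X in _ * X]mulrC.
apply: ler_sum => i _; rewrite normrM.
apply: (@le_trans _ _ ((C * xn i `^ (- s)) * (D * xn (n - i)%N `^ (- s)))).
  by rewrite ler_pM.
rewrite mulrACA ler_wpM2l ?mulr_ge0 // -powRM ?(ltW (xn_gt0 _ _)) //.
apply: pow_le_anti; rewrite ?oppr_le0 // -natrM ler_nat.
have hi : (i <= n)%N by rewrite -ltnS.
by move: (nat_of_ord i) hi => j hj; nia.
Qed.

(** Summation by parts: the partial sums of [r] converge to [c], and [r'] is the sequence of partial
    sums minus [c]. *)
Lemma bigo_tail p r : p < -1 -> bigo p r ->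
  exists c r', bigo (p + 1) r' /\ r = fpsC c + (1 - fpsX) * r'.
Proof.
move=> p1 hr; pose s n := \sum_(i < n.+1) r i.
have [|c hc] := @bigo_sum_ltN1 R p s p1.
  apply: bigo_ext (bigo_shift hr) => n.
  by rewrite /s [X in _ = X - _]big_ord_recr /=; ring.
exists c, (fun n => s n - c); split => //.
apply/funext => n; rewrite mulrBl mul1r !(fpsDE, fpsNE) fpsXM /fpsC.
case: n => [|n]; first by rewrite /s big_ord1; ring.
by rewrite {1}/s big_ord_recr /= -/(s n); ring.
Qed.

(** Each step moves a factor [1 - X] from [r] to [v]: the rough factor loses one order of decay,
    while differencing lowers the exponents of [v] by one. After [m] steps both decay fast enough
    for [bigo_conv]. *)
Lemma conv_rough_steps (m : nat) B r p v q : 0 <= B ->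
  p + m%:R <= - B - 2 -> q - m%:R <= - B - 3 ->
  bigo p r -> expands q v -> expands_upto B q (r * v).
Proof.
move=> B0; elim: m r p v q => [|m ih] r p v q.
  rewrite addr0 subr0 => hp hq hr hv; apply: expands_upto_bigo.
  have -> : - B - 1 = 1 - (B + 2) by ring.
  apply: bigo_conv; first by lra.
    by apply: bigo_le hr; lra.
  by apply: expands_bigo hv; lra.
rewrite -nat1r => hp hq hr hv; have p1 : p < -1 by have := ler0n R m; lra.
have [c [r' [hr' ->]]] := bigo_tail p1 hr.
have E : (fpsC c + (1 - fpsX) * r') * v = fpsC c * v + r' * ((1 - fpsX) * v) by ring.
rewrite E; apply: (@expands_uptoD R B q (fpsC c * v)).
  apply: expands_expands_upto; apply: expands_ext (expandsZ c hv) => n.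
  by rewrite fpsCM.
have h : expands (q - 1) ((1 - fpsX) * v).
  apply: (expands_eventually_eq (N := 1)) (expands_bdiff hv) => -[//|n] _.
  by rewrite mulrBl mul1r fpsDE fpsNE fpsXM.
apply: (expands_upto_le (lexx _)) (ih r' (p + 1) _ (q - 1) _ _ hr' h); lra.
Qed.

Lemma conv_rough B r p v q : 0 <= B -> p <= - B - 2 -> p + q <= - 2 * B - 6 ->
  bigo p r -> expands q v -> expands_upto B q (r * v).
Proof.
move=> B0 hp hpq; have y0 : 0 <= - B - 2 - p by lra.
have /andP[m1] := truncn_itv y0; rewrite -nat1r => m2.
by apply: (@conv_rough_steps (Num.truncn (- B - 2 - p))) => //; lra.
Qed.

(** Since [n = (n+1) - 1], [fpsD u n] is [n + 1] times the increment of [u], plus [u n]; the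
    increment is known from [expands_fdiff_tau]. *)
Lemma expands_fpsD_tau b k : expands (b - 1) (fun n =>
  fpsD (tau b k) n - ((b + 1) * tau b k n + k%:R * tau b k.-1 n)).
Proof.
have h := expandsM (@expands_pow R 1 1 (lexx _)) (expands_fdiff_tau b k).
have E : 1 + (b - 2) = b - 1 by ring.
rewrite E in h; apply: expands_ext h => n; rewrite pow_xn1 /fpsD.
have F j : tau b j n = xn n * tau (b - 1) j n.
  by rewrite /tau pow_xnD pow_xnN1; field; rewrite nat1r.
by rewrite !F -[n.+1%:R]natr1; ring.
Qed.

Lemma expands_upto_lsum_conv B G g (l : seq (R * R * nat)) w :
  all (fun a => a.1.2 <= g) l ->
  (forall b k, b <= g -> expands_upto B G ((tau b k : fps R) * w)) ->
  expands_upto B G ((lsum l : fps R) * w).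
Proof.
move=> hl h; elim: l hl => [_|a l ih /= /andP[ha hl]].
  have -> : (lsum [::] : fps R) = 0 by apply/funext => n; rewrite /lsum big_nil.
  by rewrite mul0r; apply: expands_upto_bigo; exact: bigo0.
have -> : (lsum (a :: l) : fps R) = fpsC a.1.1 * (tau a.1.2 a.2 : fps R) + (lsum l : fps R).
  by apply/funext => n; rewrite fpsDE fpsCM /lsum big_cons.
rewrite mulrDl -mulrA; apply: (@expands_uptoD R B G (fpsC _ * _)); last exact: ih.
by apply: expands_upto_ext (expands_uptoZ a.1.1 (h _ a.2 ha)) => n; rewrite fpsCM.
Qed.

(* Induction on [g1 + g2]: since [fpsD] is a derivation almost diagonal on the
   [tau b k], a product of two of them satisfies a first-order recurrence whose
   inhomogeneous part has lower order or fewer logarithms. *)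
Lemma conv_expands_upto B G (N : nat) : 0 <= B -> forall g1 g2 u v,
  g1 <= G -> g2 <= G -> g1 + g2 + 1 <= G -> g1 + g2 <= N%:R - 2 * B - 8 ->
  expands g1 u -> expands g2 v -> expands_upto B G (u * v).
Proof.
move=> B0; elim: N => [|N ih] g1 g2 u v h1 h2 h12 hN hu hv.
  (* For [N = 0] the smaller exponent is at most [- B - 4], so its factor can be treated as a rough
     remainder. *)
  have [g12|g12] := leP g1 g2.
    apply: (expands_upto_le (lexx _) h2).
    by apply: (@conv_rough B u (g1 + 1)) => //; [lra|lra|apply: expands_bigo hu; lra].
  rewrite mulrC; apply: (expands_upto_le (lexx _) h1).
  by apply: (@conv_rough B v (g2 + 1)) => //; [lra|lra|apply: expands_bigo hv; lra].
(* Remainders of order [-B'] meet the conditions of [conv_rough] against any factor with exponents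
   at most [G]. *)
pose B' := 2 * B + 6 + `|G|; have G0 := normr_ge0 G; have GG := ler_norm G.
have [l hl hb] := hu B'; have [l' hl' hb'] := hv B'.
pose lu : fps R := lsum l; pose lv : fps R := lsum l'.
have -> : u * v = lu * lv + ((u - lu) * v + (v - lv) * lu) by ring.
apply: (@expands_uptoD R B G (lu * lv)); last first.
  apply: (@expands_uptoD R B G ((u - lu) * v)).
    apply: (expands_upto_le (lexx _) h2).
    by apply: (@conv_rough B _ (- B')) => //; rewrite /B'; lra.
  apply: (expands_upto_le (lexx _) h1).
  by apply: (@conv_rough B _ (- B')) => //; [rewrite /B'; lra|rewrite /B'; lra|exact: expands_lsum].
apply: (expands_upto_lsum_conv hl) => b1 k1 hb1; rewrite mulrC.
apply: (expands_upto_lsum_conv hl') => b2 k2 hb2; rewrite mulrC.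
have hNN : g1 + g2 <= 1 + N%:R - 2 * B - 8 by rewrite nat1r.
(* The Leibniz rule gives a first-order recurrence for [t1 * t2] with parameter [b1 + b2 + 2]; the
   errors [y1] and [y2], one order lower, fall under the induction on [N]. *)
have step j1 j2 (t1 := tau b1 j1 : fps R) (t2 := tau b2 j2 : fps R) :
    expands_upto B G (fun n => j1%:R * ((tau b1 j1.-1 : fps R) * t2) n) ->
    expands_upto B G (fun n => j2%:R * (t1 * (tau b2 j2.-1 : fps R)) n) ->
    expands_upto B G (t1 * t2).
  move=> L1 L2.
  pose y1 : fps R := fun n => fpsD t1 n - ((b1 + 1) * t1 n + j1%:R * tau b1 j1.-1 n).
  pose y2 : fps R := fun n => fpsD t2 n - ((b2 + 1) * t2 n + j2%:R * tau b2 j2.-1 n).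
  have E1 : fpsD t1 = y1 + fpsC (b1 + 1) * t1 + fpsC j1%:R * (tau b1 j1.-1 : fps R).
    by apply/funext => n; rewrite !fpsDE !fpsCM /y1; ring.
  have E2 : fpsD t2 = y2 + fpsC (b2 + 1) * t2 + fpsC j2%:R * (tau b2 j2.-1 : fps R).
    by apply/funext => n; rewrite !fpsDE !fpsCM /y2; ring.
  have L3 : expands_upto B G (y1 * t2).
    apply: (ih (b1 - 1) b2); try lra; first exact: expands_fpsD_tau.
    exact: expands_tau.
  have L4 : expands_upto B G (t1 * y2).
    apply: (ih b1 (b2 - 1)); try lra; last exact: expands_fpsD_tau.
    exact: expands_tau.
  have L := expands_uptoD (expands_uptoD L1 L2) (expands_uptoD L3 L4).
  apply: (@expands_upto_rec R (b1 + b2 + 2) B G _ _ _ _ L); last by lra.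
  move=> n.
  have : fpsD (t1 * t2) = fpsC (b1 + b2 + 2) * (t1 * t2) +
      (fpsC j1%:R * ((tau b1 j1.-1 : fps R) * t2) + fpsC j2%:R * (t1 * (tau b2 j2.-1 : fps R))
       + (y1 * t2 + t1 * y2)).
    have -> : fpsC (b1 + b2 + 2) = fpsC (b1 + 1) + fpsC (b2 + 1).
      by apply/funext => -[|i]; rewrite fpsDE /=; ring.
    by rewrite fpsDM E1 E2; ring.
  move=> /(congr1 (fun f => f n)); rewrite !fpsDE !fpsCM {1}/fpsD => h.
  by rewrite mulrDl -addrA -h; ring.
have triv j (f : fps R) : j = 0%N -> expands_upto B G (fun n => j%:R * f n).
  by move=> ->; apply: expands_upto_bigo; apply: bigo_ext (bigo0 _) => n; rewrite mul0r.
(* Inner induction on the total power of the logarithms. *)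
move: (leqnn (k1 + k2)%N); move: {2}(k1 + k2)%N => s.
elim: s k1 k2 => [|s ihs] k1 k2 hs.
  by move: hs; rewrite leqn0 addn_eq0 => /andP[/eqP h3 /eqP h4]; apply: step; apply: triv.
apply: step.
  case: k1 hs => [|k1] hs; first exact: triv.
  by apply: expands_uptoZ; apply: ihs; move: hs; rewrite addSn ltnS.
case: k2 hs => [|k2] hs; first exact: triv.
by apply: expands_uptoZ; apply: ihs; move: hs; rewrite addnS ltnS.
Qed.

Definition expandable u := exists g, expands g u.

Lemma expandableM_conv u v : expandable u -> expandable v -> expandable (u * v).
Proof.
(* The middle of the convolution contributes the exponent [g1 + g2 + 1], its two ends [g1] and
   [g2]. *)
move=> [g1 hu] [g2 hv]; pose G := Num.max (g1 + g2 + 1) (Num.max g1 g2).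
exists G; apply: expands_upto_expands => B.
apply: (@expands_upto_le `|B| _ G) => //; first exact: ler_norm.
apply: (@conv_expands_upto `|B| G (Num.truncn (g1 + g2 + 2 * `|B| + 8)).+1 _ g1 g2) => //.
- by rewrite !le_max lexx !orbT.
- by rewrite !le_max lexx !orbT.
- by rewrite !le_max lexx.
by have := truncnS_gt (g1 + g2 + 2 * `|B| + 8); lra.
Qed.

End Convolution.

(** * The three models *)

Section Expandable.
Variable R : realType.
Implicit Types (u v w f g : nat -> R).

Local Notation xn n := (n.+1%:R : R).

Lemma expandable_cst (c : R) : expandable (fun=> c).
Proof. by exists 0; apply: expands_cst. Qed.

Lemma expandableD u v : expandable u -> expandable v -> expandable (fun n => u n + v n).
Proof.
move=> [g hu] [g' hv]; exists (Num.max g g').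
apply: expandsD; first by apply: expands_le hu; rewrite le_max lexx.
by apply: expands_le hv; rewrite le_max lexx orbT.
Qed.

Lemma expandableM u v : expandable u -> expandable v -> expandable (fun n => u n * v n).
Proof. by move=> [g hu] [g' hv]; exists (g + g'); apply: expandsM. Qed.

Lemma expandableX u k : expandable u -> expandable (fun n => u n ^+ k).
Proof. by move=> [g hu]; exists (k%:R * g); apply: expandsX. Qed.

Lemma expandableZ (c : R) u : expandable u -> expandable (fun n => c * u n).
Proof. by move=> h; apply: expandableM => //; exact: expandable_cst. Qed.

Lemma expandableB u v : expandable u -> expandable v -> expandable (fun n => u n - v n).
Proof.
move=> hu hv; have := expandableD hu (expandableZ (-1) hv).
by congr expandable; apply/funext => n; rewrite mulN1r.
Qed.

Lemma expandable_sum (I : Type) (r : seq I) (P : pred I) (F : I -> nat -> R) :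
  (forall i, P i -> expandable (F i)) -> expandable (fun n => \sum_(i <- r | P i) F i n).
Proof.
move=> h; elim: r => [|i r ih].
  rewrite (_ : (fun n => _) = fun=> 0); first exact: expandable_cst.
  by apply/funext => n; rewrite big_nil.
case hi: (P i).
  rewrite (_ : (fun n => _) = fun n => F i n + \sum_(i <- r | P i) F i n).
    exact: expandableD (h i hi) ih.
  by apply/funext => n; rewrite big_cons hi.
by move: ih; congr expandable; apply/funext => n; rewrite big_cons hi.
Qed.

Lemma expandable_eventually_eq N u v :
  (forall n, (N <= n)%N -> u n = v n) -> expandable u -> expandable v.
Proof. by move=> h [g hu]; exists g; apply: expands_eventually_eq h hu. Qed.

Lemma expandable_shift u : expandable u -> expandable (fun n => u n.+1).
Proof. by move=> [g hu]; exists g; apply: expands_shift. Qed.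

Lemma expandable_unshift u : expandable (fun n => u n.+1) -> expandable u.
Proof. by move=> [g hu]; exists g; apply: expands_unshift. Qed.

Lemma expandable_rec (a : R) w y :
  (forall n, n.+1%:R * w n.+1 = (n%:R + a) * w n + y n) -> expandable y -> expandable w.
Proof.
move=> hw [g hy]; exists (Num.max (a - 1) g).
apply: expands_rec hw _ _; first by rewrite le_max lexx.
by apply: expands_le hy; rewrite le_max lexx orbT.
Qed.

Lemma expandable_powD (c b : R) : expandable (fun n => (n%:R + c) `^ b).
Proof.
exists b; apply: expands_ext (jet_expands (jet_pow (c - 1) b)) => n.
by congr (_ `^ _); rewrite -natr1; ring.
Qed.

Lemma expandable_ln : expandable (fun n => ln (n%:R : R)).
Proof.
exists 0; apply: expands_ext (jet_expands (@jet_ln R (-1))) => n.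
by congr ln; rewrite -natr1; ring.
Qed.

Lemma expandable_nat : expandable (fun n => n%:R : R).
Proof.
apply: (@expandable_eventually_eq 0) (expandable_powD 0 1) => n _.
by rewrite addr0 powRr1.
Qed.

Lemma expandable_natDV (c : R) : expandable (fun n => (n%:R + c)^-1).
Proof.
have [N hN] := xn_eventually_gt (c - 1).
apply: (@expandable_eventually_eq N) (expandable_powD c (-1)) => n /hN h.
by rewrite powR_inv1 //; move: h; rewrite -natr1; lra.
Qed.

Lemma expandable_natDM (c : R) u : expandable u -> expandable (fun n => (n%:R + c) * u n).
Proof.
by apply: expandableM; apply: expandableD; [exact: expandable_nat|exact: expandable_cst].
Qed.

(** Plays the part of Stirling's formula: the ratios of consecutive terms determine the expansion up
    to a constant factor, whose value does not matter. *)
Lemma expandable_ratio (b : R) u : (forall n, 0 < u n) ->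
  expands (-2) (fun n => ln (u n.+1) - ln (u n) - b / xn n) ->
  expandable u /\ expandable (fun n => (u n)^-1).
Proof.
move=> u0 h; split.
  exists b; apply: expands_ext (expands_expR_antidiff h) => n.
  by rewrite lnK // posrE.
exists (- b); apply: expands_ext (@expands_expR_antidiff R (- b) (fun n => - ln (u n)) _) => [n|].
  by rewrite expRN lnK // posrE.
by apply: expands_ext (expandsN h) => n; ring.
Qed.

(** For [n] above [base M] this is the expectation of [u (K n) * v (n - a - K n)], with
    deterministic [u] and [v]; the masses vanish for [k >= n]. *)
Definition split_conv (M : tree_model) u v n : R :=
  \sum_(k < n) split_prob R M n k * (u k * v (n - Defs.shift M - k)%N).

Lemma split_conv_BST u v n :
  split_conv BST u v n.+1 = n.+1%:R^-1 * ((u : fps R) * (v : fps R)) n.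
Proof.
rewrite fpsME mulr_sumr; apply: eq_bigr => k _.
by rewrite /= ltn_ord subn1.
Qed.

Lemma BST_transfer f g : expandable g ->
  (forall n, (0 < n)%N -> f n = g n + (split_conv BST f (fun=> 1) n + split_conv BST (fun=> 1) f n)) ->
  expandable f.
Proof.
move=> hg hf; pose S n := \sum_(i < n) f i.
have E n : n%:R * f n = n%:R * g n + 2 * S n.
  case: n => [|n]; first by rewrite /S big_ord0; ring.
  rewrite hf // !split_conv_BST.
  have -> : ((fun=> 1) : fps R) * (f : fps R) = (f : fps R) * ((fun=> 1) : fps R) by rewrite mulrC.
  have -> : ((f : fps R) * ((fun=> 1) : fps R)) n = S n.+1.
    by rewrite fpsME; apply: eq_bigr => i _; rewrite mulr1.
  by field; rewrite nat1r pnatr_eq0.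
(* Differencing [E] turns [2 * S n] into [2 * f n], which gives the parameter 2 and the
   inhomogeneous part [fpsD g]. *)
apply: (@expandable_rec 2 f (fpsD (g : fps R))).
  move=> n; rewrite /fpsD E [(n%:R + 2) * _]mulrDl E /S big_ord_recr /=.
  by rewrite -/(S n); ring.
apply: expandableB; last by apply: expandableM => //; exact: expandable_nat.
apply: expandableM; apply: (@expandable_shift (fun n => _)) => //; exact: expandable_nat.
Qed.

End Expandable.

(** * Uniform binary trees *)

Section UniformBinaryModel.
Variable R : realType.
Implicit Types (u v w f g : nat -> R).

Local Notation xn n := (n.+1%:R : R).

(** The series of [(1 - X)^(-1/2)]. *)
Definition central_binom : fps R := dilate 4^-1 (fun n => 'C(n.*2, n)%:R).
(** The Catalan series at [X/4], that is [2 (1 - sqrt (1 - X)) / X]. *)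
Definition scaled_catalan : fps R := dilate 4^-1 (catalan R).

Lemma central_binomS n :
  xn n * central_binom n.+1 = (n%:R + 2^-1) * central_binom n.
Proof.
rewrite /central_binom /dilate.
have h1 := mul_bin_diag n.+1.*2 n; have h2 := mul_bin_down n.*2.+1 n.
rewrite /= in h1 h2; rewrite doubleS in h1.
rewrite (_ : (n.*2.+1 - n)%N = n.+1) in h2; last by lia.
have h : (n.+1 * 'C(n.+1.*2, n.+1) = 2 * (n.*2.+1 * 'C(n.*2, n)))%N.
  by rewrite doubleS h2 -h1; lia.
have /(congr1 (fun k => k%:R : R)) := h; rewrite !natrM => hR.
have -> : xn n * (4^-1 ^+ n.+1 * 'C(n.+1.*2, n.+1)%:R) =
  4^-1 ^+ n.+1 * (xn n * 'C(n.+1.*2, n.+1)%:R) by ring.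
by rewrite hR exprS -[n.*2.+1%:R]natr1 -mul2n natrM; field.
Qed.

Lemma central_binom_gt0 n : 0 < central_binom n.
Proof.
rewrite /central_binom /dilate mulr_gt0 ?exprn_gt0 ?invr_gt0 // ltr0n bin_gt0; lia.
Qed.

Lemma scaled_catalanE n : scaled_catalan n = central_binom n / xn n.
Proof. by rewrite /scaled_catalan /central_binom /dilate /catalan mulrA. Qed.

Lemma scaled_catalan_gt0 n : 0 < scaled_catalan n.
Proof. by rewrite scaled_catalanE divr_gt0 ?central_binom_gt0 ?ltr0n. Qed.

Lemma expandable_central_binom :
  expandable central_binom /\ expandable (fun n => (central_binom n)^-1).
Proof.
(* The ratio of consecutive terms is [1 - 1/(2x)] with [x = n + 1]. *)
apply: (@expandable_ratio R (- 2^-1)); first exact: central_binom_gt0.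
apply: expands_ext (expands_ln1D1 (- 2^-1)) => n; congr (_ - _).
rewrite -ln_div ?posrE ?central_binom_gt0 //; congr ln.
have b0 := lt0r_neq0 (central_binom_gt0 n).
have -> : central_binom n.+1 = (n%:R + 2^-1) * central_binom n / xn n.
  by rewrite -central_binomS mulrC mulKf // pnatr_eq0.
by rewrite -[n.+1%:R]natr1; field; rewrite b0 natr1 pnatr_eq0.
Qed.

Lemma expandable_scaled_catalan :
  expandable scaled_catalan /\ expandable (fun n => (scaled_catalan n)^-1).
Proof.
have [h1 h2] := expandable_central_binom; split.
  apply: (expandable_eventually_eq (N := 0)) (expandableM h1 (expandable_natDV 1)) => n _.
  by rewrite scaled_catalanE natr1.
apply: (expandable_eventually_eq (N := 0)) (expandable_natDM 1 h2) => n _.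
by rewrite scaled_catalanE natr1 invf_div.
Qed.

(** The factor 4 comes from the scaling: the two subtree sizes add up to [n], one less than the
    total. *)
Lemma split_conv_UniformBinary u v n :
  split_conv UniformBinary u v n.+1 = (4 * scaled_catalan n.+1)^-1 *
  (((fun k => scaled_catalan k * u k) : fps R) * ((fun k => scaled_catalan k * v k) : fps R)) n.
Proof.
rewrite fpsME mulr_sumr; apply: eq_bigr => k _ /=.
rewrite ltn_ord !subn1 /= /scaled_catalan /dilate.
have c0 : catalan R n.+1 != 0.
  rewrite /catalan mulf_neq0 ?invr_eq0 ?pnatr_eq0 // -lt0n bin_gt0; lia.
have h : 4^-1 ^+ n = 4^-1 ^+ k * 4^-1 ^+ (n - k) :> R by rewrite -exprD subnKC // -ltnS.
have p0 j : 4^-1 ^+ j != 0 :> R by rewrite expf_neq0 // invr_eq0.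
rewrite exprS h; field.
by rewrite c0 !expf_neq0 ?pnatr_eq0.
Qed.

Lemma expandable_split_conv_UniformBinary u v :
  expandable u -> expandable v -> expandable (split_conv UniformBinary u v).
Proof.
move=> hu hv; have [h1 h2] := expandable_scaled_catalan; apply: expandable_unshift.
have h := expandableM_conv (expandableM h1 hu) (expandableM h1 hv).
have := expandableZ 4^-1 (expandableM (expandable_shift h2) h).
congr expandable; apply/funext => n.
by rewrite split_conv_UniformBinary [(4 * _)^-1]invfM -mulrA.
Qed.

(** The series of [sqrt (1 - X)]. *)
Definition inv_central_binom : fps R := 1 - fpsC 2^-1 * (fpsX * scaled_catalan).

Lemma inv_central_binomE n : inv_central_binom n =
  if n is m.+1 then - (2^-1 * scaled_catalan m) else 1.
Proof.
rewrite /inv_central_binom fpsDE fpsNE fpsCM fpsXM fps1E.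
by case: n => [|n]; rewrite ?mulr0 ?subr0 ?sub0r.
Qed.

(* Both sides are solutions of [(1 - X) w' = 0] with [w 0 = 1]. *)
Lemma central_binomK : central_binom * inv_central_binom = 1.
Proof.
have Eb : fpsD central_binom = fpsC 2^-1 * central_binom.
  by apply/funext => n; rewrite /fpsD central_binomS fpsCM; ring.
have Es : fpsD inv_central_binom = - (fpsC 2^-1 * inv_central_binom).
  apply/funext => n; rewrite /fpsD fpsNE fpsCM !inv_central_binomE.
  case: n => [|n].
    by rewrite scaled_catalanE /central_binom /dilate expr0 bin0; field.
  have h := central_binomS n; rewrite !scaled_catalanE.
  have -> : central_binom n.+1 = (n%:R + 2^-1) * central_binom n / xn n.
    by rewrite -h mulrC mulKf // pnatr_eq0.
  have n0 := ltr0Sn R n; have n1 := ltr0Sn R n.+1.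
  by rewrite -[n.+2%:R]natr1 -[n.+1%:R]natr1; field; rewrite !gt_eqF //; have := ler0n R n; lra.
have E : fpsD (central_binom * inv_central_binom) = 0.
  by rewrite fpsDM Eb Es; ring.
have h0 : (central_binom * inv_central_binom) 0%N = 1.
  by rewrite fpsME big_ord1 inv_central_binomE /central_binom /dilate expr0 bin0 !mulr1.
apply/funext => -[//|n]; rewrite fps1E /=; elim: n => [|n ih].
  by have := congr1 (fun f => f 0%N) E; rewrite /fpsD mul0r subr0 mul1r fps0E.
have := congr1 (fun f => f n.+1) E; rewrite /fpsD ih mulr0 subr0 fps0E => /eqP.
by rewrite mulf_eq0 pnatr_eq0 => /eqP.
Qed.

Lemma UniformBinary_transfer f g : expandable g ->
  (forall n, (0 < n)%N -> f n = g n +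
    (split_conv UniformBinary f (fun=> 1) n + split_conv UniformBinary (fun=> 1) f n)) ->
  expandable f.
Proof.
move=> hg hf; have [h1 h2] := expandable_scaled_catalan.
pose phi : fps R := fun n => scaled_catalan n * f n.
(* The recurrence says nothing at index 0, so the initial value enters [psi] as it is. *)
pose psi : fps R := fun n => if n is 0%N then phi 0%N else scaled_catalan n * g n.
have E : inv_central_binom * phi = psi.
  apply/funext => n.
  have -> : inv_central_binom * phi = phi - fpsC 2^-1 * (fpsX * (phi * scaled_catalan)).
    by rewrite /inv_central_binom; ring.
  rewrite fpsDE fpsNE fpsCM fpsXM; case: n => [|n]; first by rewrite mulr0 subr0.
  rewrite {1}/phi hf // !split_conv_UniformBinary.
  have -> : ((fun k => scaled_catalan k * 1) : fps R) = scaled_catalan.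
    by apply/funext => k; rewrite mulr1.
  rewrite -/phi [scaled_catalan * phi]mulrC /psi.
  by field; rewrite gt_eqF // scaled_catalan_gt0.
have E' : phi = central_binom * psi by rewrite -E mulrA central_binomK mul1r.
have hpsi : expandable psi.
  by apply: (expandable_eventually_eq (N := 1)) (expandableM h1 hg) => -[].
have := expandableM h2 (expandableM_conv expandable_central_binom.1 hpsi).
rewrite -E'; congr expandable; apply/funext => n.
by rewrite /phi mulKf // gt_eqF // scaled_catalan_gt0.
Qed.

End UniformBinaryModel.

(** * Union--find trees *)

Section UnionFindModel.
Variable R : realType.
Implicit Types (u v w f g : nat -> R).

Local Notation xn n := (n.+1%:R : R).

(* The tree function [T = X exp T], rescaled to radius of convergence 1. *)
Definition scaled_tree : fps R :=
  dilate (expR (-1)) (fun n => if n is m.+1 then n%:R ^+ m / n`!%:R else 0).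

Local Notation T := scaled_tree.

Lemma scaled_tree0 : T 0%N = 0. Proof. by rewrite /scaled_tree /dilate mulr0. Qed.

Lemma scaled_treeS n : T n.+1 = expR (-1) ^+ n.+1 * (xn n ^+ n / n.+1`!%:R).
Proof. by []. Qed.

Lemma scaled_tree_gt0 n : 0 < T n.+1.
Proof.
by rewrite scaled_treeS mulr_gt0 ?exprn_gt0 ?expR_gt0 //.
Qed.

Lemma expandable_scaled_tree : expandable T /\ expandable (fun n => (T n)^-1).
Proof.
suff [h1 h2] : expandable (fun n => T n.+1) /\ expandable (fun n => (T n.+1)^-1).
  by split; apply: expandable_unshift.
(* With [x = n + 1], [n ln (1 + 1/x) - 1] is [-1/(2x) - 1/x] up to order [-2]. *)
apply: (@expandable_ratio R (- (3 / 2))); first exact: scaled_tree_gt0.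
(* The logarithm gets multiplied by [x], so it is expanded with an error of order [-3]. *)
have h := expandsM (@expands_pow R 1 1 (lexx _)) (expands_ln1D (1 : R) 3).
have E : 1 + - 3%:R = -2 :> R by ring.
rewrite E in h; apply: expands_ext (expandsB h (expands_ln1D1 (1 : R))) => n.
have x0 : xn n != 0 by rewrite pnatr_eq0.
have r : T n.+2 / T n.+1 = (1 + 1 / xn n) ^+ n * expR (-1).
  rewrite !scaled_treeS factS natrM exprS [n.+2%:R ^+ n.+1]exprS.
  have -> : n.+2%:R ^+ n = xn n ^+ n * (1 + 1 / xn n) ^+ n.
    by rewrite -exprMn -xn_shiftE natr1.
  have F0 : n.+1`!%:R != 0 :> R by rewrite pnatr_eq0 -lt0n fact_gt0.
  have p0 : xn n ^+ n != 0 by rewrite expf_neq0.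
  have q0 : expR (-1) ^+ n.+1 != 0 :> R by rewrite expf_neq0 // gt_eqF ?expR_gt0.
  have y0 : n.+2%:R != 0 :> R by rewrite pnatr_eq0.
  move: (expR (-1) ^+ n.+1) q0 (xn n ^+ n) p0 (n.+1`!%:R) F0 => q q0 p p0 F F0.
  move: ((1 + 1 / xn n) ^+ n) (n.+2%:R) y0 => a y y0.
  by field; rewrite q0 p0 F0 y0.
have -> : ln (T n.+2) - ln (T n.+1) = n%:R * ln (1 + 1 / xn n) - 1.
  rewrite -ln_div ?posrE ?scaled_tree_gt0 // r.
  have a0 : 0 < 1 + 1 / xn n by rewrite addr_gt0 // divr_gt0 ?ltr0Sn.
  by rewrite lnM ?posrE ?exprn_gt0 ?expR_gt0 // lnXn // expRK mulr_natl.
rewrite 3!big_ord_recl big_ord0 !lift0 /= pow_xn1.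
have -> : n%:R = xn n - 1 by rewrite -natr1 addrK.
by move: (ln _) => l; move: (xn n) x0 => x x0; field.
Qed.

(** With [T_k = e^-k k^(k-1) / k!], the mass [p n k] is [T_k T_(n-k) / T_n] times [n / (2 (n-1))];
    the exponentials cancel. *)
Lemma split_conv_UnionFind u v n : split_conv UnionFind u v n.+2 =
  n.+2%:R / (2 * n.+1%:R) / T n.+2 *
  (((fun k => T k * u k) : fps R) * ((fun k => T k * v k) : fps R)) n.+2.
Proof.
rewrite fpsME big_ord_recr /= subnn scaled_tree0 mul0r mulr0 addr0.
rewrite mulr_sumr; apply: eq_bigr => -[k hk] _ /=.
rewrite subn0 hk andbT; case: k hk => [|k] hk /=.
  by rewrite scaled_tree0 !mul0r mulr0.
have [m hm] : exists m, (n.+2 - k.+1 = m.+1)%N by exists (n - k)%N; lia.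
have hn : n.+2 = (k.+1 + m.+1)%N by lia.
rewrite hm !subn1 subn2 /= /scaled_tree /dilate.
have F : 'C(n.+2, k.+1)%:R = n.+2`!%:R / (k.+1`!%:R * m.+1`!%:R) :> R.
  have f0 j : j`!%:R != 0 :> R by rewrite pnatr_eq0 -lt0n fact_gt0.
  have := @bin_fact n.+2 k.+1 (ltnW hk); rewrite hm => <-.
  by rewrite natrM natrM mulfK // mulf_neq0.
rewrite F.
have P : expR (-1) ^+ n.+2 = expR (-1) ^+ k.+1 * expR (-1) ^+ m.+1 :> R.
  by rewrite -exprD hn.
rewrite P [n.+2%:R ^+ n.+1]exprS.
have f0 j : j`!%:R != 0 :> R by rewrite pnatr_eq0 -lt0n fact_gt0.
have e0 j : expR (-1) ^+ j != 0 :> R by rewrite expf_neq0 // gt_eqF ?expR_gt0.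
have x0 j : xn j != 0 by rewrite pnatr_eq0.
have p0 : n.+2%:R ^+ n != 0 :> R by rewrite expf_neq0.
move: (expR (-1) ^+ k.+1) (e0 k.+1) (expR (-1) ^+ m.+1) (e0 m.+1) => e1 e10 e2 e20.
move: (k.+1`!%:R) (f0 k.+1) (m.+1`!%:R) (f0 m.+1) (n.+2`!%:R) (f0 n.+2) => F1 F10 F2 F20 F3 F30.
move: (n.+2%:R ^+ n) p0 (k.+1%:R ^+ k) (m.+1%:R ^+ m) => p p0 p1 p2.
move: (n.+2%:R) (x0 n.+1) (n.+1%:R) (x0 n) => x2 x20 x1 x10.
by field; rewrite x10 x20 p0 F10 F20 F30 e10 e20.
Qed.

Lemma expandable_split_conv_UnionFind u v :
  expandable u -> expandable v -> expandable (split_conv UnionFind u v).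
Proof.
move=> hu hv; have [h1 h2] := expandable_scaled_tree.
have h := expandableM_conv (expandableM h1 hu) (expandableM h1 hv).
have hc := expandableM (expandable_nat R) (expandableZ 2^-1 (expandable_natDV (-1 : R))).
apply: (expandable_eventually_eq (N := 2)) (expandableM (expandableM hc h2) h) => -[|[|n]] // _.
by rewrite split_conv_UnionFind -[n.+2%:R]natr1 addrK [(2 * _)^-1]invfM.
Qed.

(** * The tree function and the solution of the union--find recurrence *)

Section Transfer.
(** Obtained later from the recurrence for the moment of order 0: the masses add up to 1 because
    they are the law of the random variable [K n]. This replaces a combinatorial proof. *)
Hypothesis total : forall n, (1 < n)%N -> split_conv UnionFind (fun=> 1) (fun=> 1) n = 1 :> R.

(** Coefficientwise, [total] reads [n (T^2)_n = 2 (n-1) T_n], that is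
    [theta (T^2) = 2 (theta T - T)]; the Leibniz rule then allows division by 2. *)
Lemma theta_scaled_tree : T * theta T = theta T - T.
Proof.
have E : theta (T * T) = theta T - T + (theta T - T).
  apply/funext => n; rewrite !fpsDE !fpsNE /theta; case: n => [|[|n]].
  - by rewrite scaled_tree0; ring.
  - by rewrite fpsME !big_ord_recl big_ord0 /= scaled_tree0; ring.
  have := total (isT : 1 < n.+2)%N; rewrite split_conv_UnionFind.
  have -> : ((fun k => T k * 1) : fps R) = T by apply/funext => k; rewrite mulr1.
  move=> h; have t0 := scaled_tree_gt0 n.+1.
  have n0 := ltr0Sn R n; have n1 := ltr0Sn R n.+1.
  have -> : n.+2%:R * (T * T) n.+2 = 2 * n.+1%:R * T n.+2.
    move: h; move: ((T * T) n.+2) (T n.+2) t0 (n.+2%:R) n1 (n.+1%:R) n0 => X t t0 x x0 y y0 h.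
    by rewrite -[RHS]mulr1 -[X in _ = _ * X]h; field; rewrite !gt_eqF.
  by rewrite -[n.+2%:R]natr1; ring.
have E2 : theta (T * T) = T * theta T + T * theta T by rewrite thetaM; ring.
apply/funext => n; have := congr1 (fun f => f n) E; rewrite E2 !fpsDE; lra.
Qed.

(** The argument of the unscaled tree function. *)
Local Notation Z := (fpsC (expR (-1)) * fpsX : fps R).

(* [exp (- T)], through [theta A = - Z (1 + theta T)]. *)
Definition exp_neg_tree : fps R := fun n =>
  if n is m.+1 then - expR (-1) * ((m == 0)%:R + m%:R * T m) / m.+1%:R else 1.

Local Notation A := exp_neg_tree.

Lemma theta_exp_neg_tree_def : theta A = - (Z * (1 + theta T)).
Proof.
apply/funext => n; rewrite fpsNE -mulrA fpsCM fpsXM /theta.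
case: n => [|n]; first by rewrite mul0r mulr0 oppr0.
by rewrite /exp_neg_tree fpsDE fps1E; field; rewrite nat1r pnatr_eq0.
Qed.

Lemma theta_scaleX : theta Z = Z.
Proof.
apply/funext => n; rewrite /theta fpsCM /fpsX; case: n => [|[|n]]; rewrite /=; ring.
Qed.

(** The functional equation [T exp (-T) = z]. The defect [V] satisfies [theta V - T theta V = V]; as
    [T] has no constant term, this determines [(n-1) V_n] from lower coefficients. *)
Lemma scaled_treeM_exp_neg : T * A = Z.
Proof.
pose V := T * A - Z.
have E : theta V - T * theta V = V.
  have -> : theta V = theta T * A + T * theta A - Z.
    by rewrite /V thetaD thetaN thetaM theta_scaleX.
  rewrite theta_exp_neg_tree_def /V.
  have h := theta_scaled_tree.
  have -> : theta T * A + T * - (Z * (1 + theta T)) - Z -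
    T * (theta T * A + T * - (Z * (1 + theta T)) - Z) =
    (theta T - T * theta T) * A + T * T * Z - (theta T - T * theta T) * (T * Z) - Z.
    by ring.
  by rewrite h; ring.
have V0 : V 0%N = 0.
  by rewrite /V fpsDE fpsNE fpsME big_ord1 scaled_tree0 mul0r fpsCM /fpsX /= mulr0 subr0.
(* The factor [n - 1] vanishes at 1, so this coefficient is checked directly. *)
have V1 : V 1%N = 0.
  rewrite /V fpsDE fpsNE fpsME !big_ord_recl big_ord0 /= scaled_tree0 fpsCM /fpsX /=.
  by rewrite scaled_treeS /= expr1 expr0 /=; rewrite (_ : 1`! = 1%N) //; field.
suff h n : forall m, (m <= n)%N -> V m = 0.
  apply/funext => n; have := h n n (leqnn _); rewrite /V fpsDE fpsNE => /eqP.
  by rewrite subr_eq0 => /eqP.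
elim: n => [m|n ih m]; first by rewrite leqn0 => /eqP ->.
rewrite leq_eqVlt => /orP[/eqP ->|]; last exact: ih.
case: n ih => [//|n] ih.
have := congr1 (fun f => f n.+2) E; rewrite fpsDE fpsNE fpsME big1 => [|i _]; last first.
  case: i => -[|i] hi; first by rewrite scaled_tree0 mul0r.
  by rewrite /theta ih ?mulr0 //= subSS leq_subr.
rewrite subr0 /theta => /eqP; rewrite -subr_eq0 -[X in _ - X]mul1r -mulrBl.
by rewrite -[n.+2%:R]natr1 addrK mulf_eq0 pnatr_eq0 => /eqP.
Qed.

Lemma theta_exp_neg_tree : theta A = - (A * theta T).
Proof.
rewrite theta_exp_neg_tree_def -scaled_treeM_exp_neg.
have -> : T * A * (1 + theta T) = A * (T + T * theta T) by ring.
by rewrite theta_scaled_tree; ring.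
Qed.

Lemma expandable_exp_neg_tree : expandable A.
Proof.
apply: expandable_unshift.
have h := expandable_natDM 0 expandable_scaled_tree.1.
apply: (expandable_eventually_eq (N := 1))
  (expandableZ (- expR (-1)) (expandableM h (expandable_natDV 1))) => -[//|n] _.
by rewrite /exp_neg_tree /= add0r addr0 natr1 mulrA.
Qed.

Lemma UnionFind_transfer f g : expandable g ->
  (forall n, (1 < n)%N -> f n = g n +
    (split_conv UnionFind f (fun=> 1) n + split_conv UnionFind (fun=> 1) f n)) ->
  expandable f.
Proof.
move=> hg hf; have [hT hTi] := expandable_scaled_tree.
pose Phi : fps R := fun n => T n * f n.
(* The factor [n - 1] clears the denominator of the masses. *)
pose H : fps R := fun n => (n%:R + -1) * (T n * g n).
have E : theta Phi - Phi = H + theta (Phi * T).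
  apply/funext => n; rewrite !fpsDE fpsNE /theta.
  case: n => [|[|n]].
  - by rewrite /Phi /H scaled_tree0; ring.
  - by rewrite fpsME !big_ord_recl big_ord0 /= /Phi /H scaled_tree0; ring.
  have -> : n.+2%:R * Phi n.+2 - Phi n.+2 = (n.+2%:R - 1) * Phi n.+2 by ring.
  rewrite {1}/Phi hf // !split_conv_UnionFind.
  have -> : ((fun k => T k * 1) : fps R) = T by apply/funext => k; rewrite mulr1.
  rewrite -/Phi [T * Phi]mulrC /H -[n.+2%:R]natr1 addrK.
  have t0 := lt0r_neq0 (scaled_tree_gt0 n.+1).
  by field; rewrite t0 nat1r pnatr_eq0.
(* [(1 - T) exp (-T)] is an integrating factor of [E]: the new equation [EPsi] is solved coefficient
   by coefficient. *)
pose Psi := Phi * (1 - T) * A.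
have h := theta_scaled_tree.
have EPsi : theta Psi = A * H + Psi.
  rewrite /Psi !thetaM thetaD thetaN theta1 theta_exp_neg_tree.
  have H' : H = theta Phi - Phi - theta Phi * T - Phi * theta T.
    by move: E; rewrite thetaM => /eqP; rewrite -subr_eq => /eqP <-; ring.
  have -> : (theta Phi * (1 - T) + Phi * (0 - theta T)) * A + Phi * (1 - T) * - (A * theta T) =
    A * (theta Phi * (1 - T) - Phi * theta T - Phi * theta T + Phi * (T * theta T)) by ring.
  by rewrite h H'; ring.
(* Dividing by the integrating factor amounts to multiplying by [theta T / z], since
   [(1 - T) theta T = T] and [T exp (-T) = z]. *)
have EPhi : Psi * theta T = Z * Phi.
  rewrite -scaled_treeM_exp_neg /Psi.
  have -> : Phi * (1 - T) * A * theta T = Phi * A * (theta T - T * theta T) by ring.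
  by rewrite h; ring.
have hH : expandable H by apply: expandable_natDM; apply: expandableM.
have hPsi : expandable Psi.
  have hc := expandableM (expandable_natDV (-1)) (expandableM_conv expandable_exp_neg_tree hH).
  apply: (expandable_eventually_eq (N := 2)) hc => -[|[|n]] // _.
  have := congr1 (fun f => f n.+2) EPsi; rewrite fpsDE /theta => e.
  have -> : (A * H) n.+2 = (n.+2%:R + -1) * Psi n.+2.
    by rewrite mulrDl e; ring.
  by rewrite mulKf // -[n.+2%:R]natr1 addrK pnatr_eq0.
have hth : expandable (theta T).
  by apply: expandableM => //; exact: expandable_nat.
have hPhi : expandable Phi.
  (* [Z] shifts by one and scales by [exp (-1)]; the shift and the factor [expR 1] undo this. *)
  have hc := expandableZ (expR 1) (expandable_shift (expandableM_conv hPsi hth)).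
  apply: (expandable_eventually_eq (N := 0)) hc => n _.
  by rewrite EPhi -mulrA fpsCM fpsXM mulrA -expRD subrr expR0 mul1r.
apply: (expandable_eventually_eq (N := 1)) (expandableM hTi hPhi) => -[//|n] _.
by rewrite /Phi mulKf // gt_eqF // scaled_tree_gt0.
Qed.

End Transfer.
End UnionFindModel.

(** * From expansions to every order to a complete expansion *)

Section Uniqueness.
Variable R : realType.
Implicit Types (b e : R) (l : seq (R * R * nat)) (p : {poly R}).

Local Notation xn n := (n.+1%:R : R).
Hint Resolve xn_gt0 xn_ge1 xn_neq0 pow_xn_gt0 : core.

(** The coefficient of [x^b] as a polynomial in [ln x], once repeated exponents are merged. *)
Definition coef_at l b : {poly R} := \sum_(q <- l | q.1.2 == b) q.1.1 *: 'X^(q.2).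

Definition exponents l := [seq q.1.2 | q <- l].

Lemma coef_at_cat l1 l2 b : coef_at (l1 ++ l2) b = coef_at l1 b + coef_at l2 b.
Proof. by rewrite /coef_at big_cat. Qed.

Lemma coef_at_scale (c : R) l b :
  coef_at [seq (c * q.1.1, q.1.2, q.2) | q <- l] b = c *: coef_at l b.
Proof.
rewrite /coef_at big_map scaler_sumr; apply: eq_bigr => q _.
by rewrite scalerA.
Qed.

Lemma coef_at_notin l b : b \notin exponents l -> coef_at l b = 0.
Proof.
move=> hb; rewrite /coef_at big_seq_cond big1 // => q /andP[hq /eqP E].
by case/negP: hb; rewrite -E; apply: map_f.
Qed.

Lemma lsumE l (s : seq R) n : uniq s -> {subset exponents l <= s} ->
  lsum l n = \sum_(b <- s) (coef_at l b).[ln (xn n)] * xn n `^ b.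
Proof.
move=> us; elim: l => [_|q l ih hs].
  rewrite /lsum big_nil big1 // => b _; by rewrite /coef_at big_nil horner0 mul0r.
rewrite /lsum big_cons -/(lsum l n) ih; last first.
  by move=> b hb; apply: hs; rewrite inE hb orbT.
have qs : q.1.2 \in s by apply: hs; rewrite inE eqxx.
rewrite !(big_rem _ qs) /= addrA.
rewrite [coef_at (q :: l) _]/coef_at big_cons eqxx -/(coef_at l q.1.2) hornerD mulrDl.
congr (_ + _ + _); first by rewrite /tau hornerZ hornerXn; ring.
rewrite !big_seq; apply: eq_bigr => b; rewrite mem_rem_uniq // inE => /andP[hb _].
by rewrite /coef_at big_cons eq_sym (negbTE hb).
Qed.

(** With [y = ln x], this prevents a nonzero coefficient from being negligible. In [p * 'X + c] the
    first term dominates once [y >= 1 + |c| / a]. *)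
Lemma poly_away0 p : p != 0 -> exists Y a : R, 0 < a /\ forall y, Y <= y -> a <= `|p.[y]|.
Proof.
elim/poly_ind: p => [|p c ih]; first by rewrite eqxx.
have [->|p0 _] := eqVneq p 0.
  rewrite mul0r add0r polyC_eq0 => c0; exists 0, `|c|; split; first by rewrite normr_gt0.
  by move=> y _; rewrite hornerC.
have [Y [a [a0 h]]] := ih p0.
exists (Num.max Y (1 + `|c| / a)), a; split => // y; rewrite ge_max => /andP[/h h1 h2].
rewrite !hornerE.
have c0 : 0 <= `|c| / a by rewrite divr_ge0 // ltW.
have y0 : 0 <= y by lra.
apply: (@le_trans _ _ (`|p.[y] * y| - `|c|)); last first.
  by rewrite lerBlDr -{1}[p.[y] * y](addrK c) (le_trans (ler_normB _ _)).
rewrite normrM [`|y|]ger0_norm //.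
have h3 : a * y <= `|p.[y]| * y by rewrite ler_wpM2r.
have h4 : a * (1 + `|c| / a) <= a * y by rewrite ler_wpM2l // ltW.
have : a * (1 + `|c| / a) = a + `|c| by field; rewrite gt_eqF.
by lra.
Qed.

Lemma ln_xn_eventually (Y : R) : exists N, forall n, (N <= n)%N -> Y <= ln (xn n).
Proof.
exists (Num.truncn (expR Y)).+1 => n hn.
rewrite -[Y]expRK ler_ln ?posrE ?expR_gt0 //.
by apply/ltW/(lt_trans (truncnS_gt _)); rewrite ltr_nat ltnS.
Qed.

Lemma poly_ln_not_small p e : e < 0 -> bigo e (fun n => p.[ln (xn n)]) -> p = 0.
Proof.
move=> e0 hb; apply/eqP/negP => /negP /poly_away0[Y [a [a0 h]]].
have [N hN] := ln_xn_eventually Y.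
have a2 : 0 < a / 2 by lra.
have [N' hN'] := bigo_small e0 a2 hb.
have h1 := h _ (hN (maxn N N') (leq_maxl _ _)).
have := hN' (maxn N N') (leq_maxr _ _); lra.
Qed.

Lemma expands_polyln p b : expands b (fun n => p.[ln (xn n)] * xn n `^ b).
Proof.
elim/poly_ind: p => [|p c ih].
  by apply: expands_ext (expands0 _) => n; rewrite horner0 mul0r.
have h := expandsM (@expands_lnX R 1) ih; rewrite add0r in h.
apply: expands_ext (expandsD h (expandsZ c (expands_pow (lexx b)))) => n.
by rewrite hornerMXaddC; ring.
Qed.

Lemma bigo_polyln_sum (F : R -> {poly R}) (s : seq R) b0 : (forall b, b \in s -> b < b0) ->
  exists2 e, e < b0 & bigo e (fun n => \sum_(b <- s) (F b).[ln (xn n)] * xn n `^ b).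
Proof.
elim: s => [_|b s ih h].
  by exists (b0 - 1); [lra|apply: bigo_ext (bigo0 _) => n; rewrite big_nil].
have [|e he hb] := ih; first by move=> c hc; apply: h; rewrite inE hc orbT.
have bb := h b (mem_head _ _); pose e' := Num.max e ((b + b0) / 2).
exists e'; first by rewrite gt_max he; lra.
have h1 : bigo e' (fun n => (F b).[ln (xn n)] * xn n `^ b).
  apply: bigo_le (expands_bigo _ (expands_polyln (F b) b)).
    by rewrite /e' le_max; apply/orP; right; exact: lexx.
  by lra.
have h2 : e <= e' by rewrite le_max lexx.
by apply: bigo_ext (bigoD h1 (bigo_le h2 hb)) => n; rewrite big_cons.
Qed.

Lemma seq_max (s : seq R) : s != [::] -> exists2 m, m \in s & forall b, b \in s -> b <= m.
Proof.
elim: s => // a [|a' s] ih _; first by exists a; rewrite ?mem_head // => b; rewrite inE => /eqP ->.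
have [//|m hm h] := ih; have [am|am] := leP a m.
  exists m; first by rewrite inE hm orbT.
  by move=> b; rewrite inE => /orP[/eqP ->|/h].
exists a; first exact: mem_head.
by move=> b; rewrite inE => /orP[/eqP ->//|/h]; lra.
Qed.

(** Otherwise take the largest exponent [m > e] with a nonzero coefficient: after division by [x^m]
    everything else is small, so a nonzero polynomial in [ln x] would tend to 0. *)
Lemma coef_at_unique l e b : bigo e (lsum l) -> e < b -> coef_at l b = 0.
Proof.
move=> hl eb; apply/eqP/negP => /negP hb.
pose s := undup (exponents l); have us : uniq s := undup_uniq _.
pose s' := [seq c <- s | (e < c) && (coef_at l c != 0)].
have bs : b \in s.
  by rewrite mem_undup; apply: contraNT hb => /coef_at_notin ->.
have [|m] := @seq_max s'.
  by apply/eqP => h; suff : b \in [::] by []; rewrite -h mem_filter eb hb bs.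
rewrite mem_filter => /andP[/andP[em pm] ms] hm.
have E n : lsum l n = (coef_at l m).[ln (xn n)] * xn n `^ m +
    \sum_(c <- [seq c <- rem m s | coef_at l c != 0]) (coef_at l c).[ln (xn n)] * xn n `^ c.
  rewrite (@lsumE l s) //; last by move=> c; rewrite mem_undup.
  rewrite (big_rem _ ms) big_filter /=; congr (_ + _).
  rewrite [RHS]big_mkcond /=; apply: eq_bigr => c _.
  by case: eqP => [->|]; rewrite ?horner0 ?mul0r.
have [|e' he' hb'] := @bigo_polyln_sum (coef_at l) [seq c <- rem m s | coef_at l c != 0] m.
  move=> c; rewrite mem_filter mem_rem_uniq // inE => /andP[c0 /andP[cm cs]].
  rewrite lt_neqAle cm /=; have [ce|ec] := leP c e; first by lra.
  by apply: hm; rewrite mem_filter ec c0 cs.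
case/eqP: pm; pose d := Num.max e e'.
have d1 : e <= d by rewrite le_max lexx.
have d2 : e' <= d by rewrite le_max lexx orbT.
apply: (@poly_ln_not_small _ (d - m)); first by rewrite subr_lt0 gt_max em.
apply: bigo_ext (bigoM (bigoB (bigo_le d1 hl) (bigo_le d2 hb')) (@bigo_pow R (- m))) => n.
by rewrite E addrK -mulrA -pow_xnD subrr powRr0 mulr1.
Qed.

Lemma polyln_sum_le (F : R -> {poly R}) (s : seq R) b0 : (forall b, b \in s -> b <= b0) ->
  exists (m : nat) (c : R), 0 <= c /\ forall n, 1 <= ln (xn n) ->
    `|\sum_(b <- s) (F b).[ln (xn n)] * xn n `^ b| <= c * (xn n `^ b0 * ln (xn n) ^+ m).
Proof.
have P p : exists (m : nat) (c : R), 0 <= c /\ forall y, 1 <= y -> `|p.[y]| <= c * y ^+ m.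
  elim/poly_ind: p => [|p c [m [C [C0 h]]]].
    by exists 0%N, 0; split => // y _; rewrite horner0 normr0 mul0r.
  exists m.+1, (C + `|c|); split; first by rewrite addr_ge0.
  move=> y y1; rewrite !hornerE (le_trans (ler_normD _ _)) // mulrDl lerD //.
    rewrite normrM [`|y|]ger0_norm ?(le_trans ler01) // exprSr mulrA.
    by rewrite ler_wpM2r ?h // (le_trans ler01).
  by rewrite ler_peMr // exprn_ege1.
elim: s => [_|b s ih h].
  by exists 0%N, 0; split => // n _; rewrite big_nil normr0 mul0r.
have [|m [C [C0 h1]]] := ih; first by move=> c hc; apply: h; rewrite inE hc orbT.
have [m' [C' [C0' h2]]] := P (F b).
exists (m + m')%N, (C' + C); split; first by rewrite addr_ge0.
move=> n y1; rewrite big_cons (le_trans (ler_normD _ _)) // mulrDl lerD //.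
  rewrite normrM [`|_ `^ b|]ger0_norm ?powR_ge0 // [_ * ln _ ^+ _]mulrC mulrA.
  apply: ler_pM; rewrite ?powR_ge0 //.
    apply: (le_trans (h2 _ y1)); rewrite ler_wpM2l // exprD ler_peMl ?exprn_ege1 //.
    by rewrite exprn_ge0 // (le_trans ler01).
  by apply: pow_xn_le; apply: h; rewrite mem_head.
apply: (le_trans (h1 n y1)); rewrite ler_wpM2l // ler_wpM2l ?powR_ge0 //.
by rewrite exprD ler_peMr ?exprn_ege1 // exprn_ge0 // (le_trans ler01).
Qed.

Lemma expandable_complete_expansion (u : nat -> R) : expandable u -> complete_expansion u.
Proof.
(* Expansions use the variable [n + 1]; the shift makes it the argument of [u]. *)
move=> /expandable_shift[g hw].
have /choice[l hl] : forall N : nat, exists l, bigo (- N%:R) (fun n => u n.+1 - lsum l n).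
  by move=> N; have [l _ hl] := hw N%:R; exists l.
have coh N N' b : (N <= N')%N -> - N%:R < b -> coef_at (l N) b = coef_at (l N') b.
  move=> NN bN; apply/eqP; rewrite -subr_eq0 -scaleN1r -coef_at_scale -coef_at_cat.
  apply/eqP/(@coef_at_unique _ (- N%:R)) => //.
  have h : - N'%:R <= - N%:R :> R by rewrite lerN2 ler_nat.
  apply: bigo_ext (bigoB (bigo_le h (hl N')) (hl N)) => n.
  by rewrite lsum_cat lsum_scale; ring.
(* The coefficient of exponent [b] is read off at a precision beyond [-b]; by [coh] every such
   precision gives the same. *)
pose q b := coef_at (l (Num.truncn (- b)).+1) b.
have qE (N : nat) b : - N%:R < b -> q b = coef_at (l N) b.
  move=> h; have h' : - (Num.truncn (- b)).+1%:R < b by rewrite ltrNl truncnS_gt.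
  by rewrite /q (coh _ _ _ (leq_maxl _ N) h') (coh _ _ _ (leq_maxr (Num.truncn (- b)).+1 N) h).
(* The nonpositive integers are added as exponents, possibly with null coefficients, so that [beta]
   never stops and tends to [-oo]. *)
pose A b := q b != 0 \/ exists N : nat, b = - N%:R.
pose S (N : nat) := exponents (l N) ++ [seq - i%:R | i <- iota 0 N].
have AS (N : nat) b : A b -> - N%:R < b -> b \in S N.
  move=> hA hb; rewrite mem_cat; apply/orP; case: hA => [h|[M E]].
    by left; apply: contraNT h; rewrite (qE N) // => /coef_at_notin ->.
  right; rewrite E; apply/mapP; exists M => //.
  by rewrite mem_iota /=; move: hb; rewrite E ltrN2 ltr_nat.
(* By [AS], [A] is finite above every level, and it has elements below every [x]; hence there is a
   greatest one. *)
have /choice[nx hnx] : forall x, exists m, [/\ A m, m < x & forall b, A b -> b < x -> b <= m].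
  move=> x; pose M := (Num.truncn (- x)).+1.
  have Mx : - M%:R < x by rewrite ltrNl truncnS_gt.
  pose s := [seq b <- S M.+1 | `[< A b >] && (b < x)].
  have Ms : - M%:R \in s.
    rewrite mem_filter Mx andbT; apply/andP; split; first by apply/asboolP; right; exists M.
    by apply: AS; [right; exists M|rewrite ltrN2 ltr_nat].
  have [|m] := @seq_max s; first by apply/eqP => h; rewrite h in Ms.
  rewrite mem_filter => /andP[/andP[/asboolP Am mx] _] hm; exists m; split => // b Ab bx.
  have [bM|bM] := leP b (- M%:R); first exact: le_trans (hm _ Ms).
  apply: hm; rewrite mem_filter bx andbT; apply/andP; split; first exact/asboolP.
  by apply: AS => //; apply: lt_trans bM; rewrite ltrN2 ltr_nat.
have [x0 hx0] : exists x0, forall b, A b -> b < x0.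
  have [//|m _ hm] := @seq_max (0 :: S 0%N).
  exists (m + 1) => b Ab; have m0 : 0 <= m by apply: hm; rewrite mem_head.
  have [b0|b0] := leP b 0; first by lra.
  have : b <= m by apply: hm; rewrite inE AS ?orbT //; rewrite oppr0.
  by lra.
(* [beta] enumerates [A] in decreasing order. *)
pose beta := fix beta j := if j is j'.+1 then nx (beta j') else nx x0.
have bA j : A (beta j) by case: j => [|j]; [have [] := hnx x0|have [] := hnx (beta j)].
have bS j : beta j.+1 < beta j by have [_ h _] := hnx (beta j).
have bdec i j : (i < j)%N -> beta j < beta i.
  elim: j => // j ih; rewrite ltnS leq_eqVlt => /orP[/eqP ->|/ih h]; first exact: bS.
  exact: lt_trans (bS j) h.
have binj : injective beta.
  by move=> i j E; case: (ltngtP i j) => // /bdec; rewrite E ltxx.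
have ball b j : A b -> beta j < b -> exists2 i, (i < j)%N & b = beta i.
  move=> Ab; elim: j => [/=|j ih] h.
    have [_ _ /(_ b Ab (hx0 b Ab))] := hnx x0; move: h => /=; lra.
  have [bj|bj|bj] := ltgtP b (beta j).
  - have [_ _ /(_ b Ab bj)] := hnx (beta j); move: h => /=; lra.
  - by have [i hi ->] := ih bj; exists i => //; apply: ltnW.
  - by exists j.
have bfar (N : nat) : exists j, beta j <= - N%:R.
  apply/not_existsP => h.
  have h' j : - N%:R < beta j by rewrite ltNge; apply/negP/h.
  pose t := [seq beta j | j <- iota 0 (size (S N)).+1].
  have ut : uniq t.
    by rewrite map_inj_uniq ?iota_uniq.
  have tS : {subset t <= S N} by move=> _ /mapP[j _ ->]; exact: AS.
  by have := uniq_leq_size ut tS; rewrite size_map size_iota ltnn.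
exists beta, (fun j => q (beta j)); split => //.
  apply/cvgrNyPle => y.
  have [j hj] := bfar (Num.truncn (- y)).+1; exists j => // i /= ji.
  have h : beta i <= beta j.
    by move: ji; rewrite leq_eqVlt => /orP[/eqP ->//|/bdec /ltW].
  by have := truncnS_gt (- y); lra.
move=> J; pose N := (Num.truncn (- beta J)).+1.
have NJ : - N%:R < beta J by rewrite ltrNl truncnS_gt.
pose L := [seq beta j | j <- iota 0 J].
have uL : uniq L.
  by rewrite map_inj_uniq ?iota_uniq.
pose s := undup (exponents (l N) ++ L); have us : uniq s := undup_uniq _.
(* Exponents above [beta J] with nonzero coefficient are among the first [J] values of [beta]; the
   remaining terms go into the error. *)
have E n : lsum (l N) n = \sum_(j < J) (q (beta j)).[ln (xn n)] * xn n `^ beta j +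
   \sum_(b <- [seq b <- s | b <= beta J]) (coef_at (l N) b).[ln (xn n)] * xn n `^ b.
  rewrite (@lsumE (l N) s) //; last by move=> b hb; rewrite mem_undup mem_cat hb.
  rewrite (bigID (fun b => b <= beta J)) /= addrC; congr (_ + _); last first.
    by rewrite big_filter.
  transitivity (\sum_(b <- s | b \in L) (q b).[ln (xn n)] * xn n `^ b).
    rewrite big_mkcond [RHS]big_mkcond; apply: eq_bigr => b _ /=; rewrite -ltNge.
    have [bJ|bJ] := ltP (beta J) b.
      rewrite -(qE N) ?(lt_trans NJ) //; case: ifPn => // bL.
      suff -> : q b = 0 by rewrite horner0 mul0r.
      apply/eqP; apply: contraNT bL => q0; have [||i iJ ->] := @ball b J; first by left.
        by [].
      by apply: map_f; rewrite mem_iota.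
    case: ifP => // /mapP[j]; rewrite mem_iota /= => /bdec h hb.
    by move: bJ; rewrite hb; lra.
  rewrite -[LHS]big_filter (perm_big L) /=; last first.
    apply: uniq_perm; rewrite ?filter_uniq // => b.
    by rewrite mem_filter mem_undup mem_cat andb_orr; case: (b \in L); rewrite ?orbT ?andbF.
  by rewrite /L big_map -[X in iota 0 X]subn0 big_mkord.
have [|m [c [c0 hc]]] := @polyln_sum_le (coef_at (l N)) [seq b <- s | b <= beta J] (beta J).
  by move=> b; rewrite mem_filter => /andP[].
have [C C0 hC] := bigo_ge0 (hl N).
have [N1 hN1] := ln_xn_eventually 1.
exists m, (C + c), N1.+1 => // -[//|n] /= hn; have y1 := hN1 n hn.
have -> : u n.+1 - \sum_(j < J) (q (beta j)).[ln n.+1%:R] * n.+1%:R `^ beta j =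
  (u n.+1 - lsum (l N) n) +
   \sum_(b <- [seq b <- s | b <= beta J]) (coef_at (l N) b).[ln (xn n)] * xn n `^ b.
  by rewrite E; ring.
rewrite (le_trans (ler_normD _ _)) // mulrDl lerD ?hc //.
apply: (le_trans (hC n)); rewrite ler_wpM2l //.
apply: (@le_trans _ _ (xn n `^ beta J)); first by apply: pow_xn_le; exact: ltW.
by rewrite ler_peMr ?powR_ge0 // exprn_ege1.
Qed.

End Uniqueness.

(** * Moments of the random variables *)

Section FiniteSupport.
Context (d : measure_display) (T : measurableType d) (R : realType).
Variable P : probability T R.
Implicit Types (f Y Z : T -> R) (s : seq R).

Definition supported Y s := uniq s /\ {ae P, forall w, Y w \in s}.

Definition mass Y (v : R) : R := fine (P (Y @^-1` [set v])).

Lemma integral_ae_simple (I : Type) (r : seq I) (c : I -> R) (E : I -> set T) f :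
  measurable_fun setT f -> (forall i, measurable (E i)) ->
  {ae P, forall w, f w = \sum_(i <- r) c i * \1_(E i) w} ->
  (\int[P]_w (f w)%:E)%E = (\sum_(i <- r) c i * fine (P (E i)))%:E.
Proof.
move=> mf mE hf.
have iE i : P.-integrable setT (fun w => ((c i)%:E * (\1_(E i) w)%:E)%E).
  by apply: integrableZl => //; apply: integrable_indic.
transitivity (\int[P]_w (\sum_(i <- r) (c i)%:E * (\1_(E i) w)%:E)%E)%E.
  apply: ae_eq_integral => //; first exact/measurable_realfun.measurable_EFinP.
    by have /measurable_int := @integrable_sum _ _ _ P setT measurableT I r xpredT _ (fun i _ => iE i).
  apply: filterS hf => w hw _; rewrite hw -sumEFin.
  by apply: eq_bigr => i _; rewrite EFinM.
rewrite (integral_sum measurableT iE) -sumEFin; apply: eq_bigr => i _.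
rewrite integralZl //; last exact: integrable_indic.
by rewrite integral_indic // setIT EFinM fineK // fin_num_measure.
Qed.

Lemma indic_preimage1 (rT : eqType) (g : T -> rT) v w :
  \1_(g @^-1` [set v]) w = (g w == v)%:R :> R.
Proof.
rewrite indicE; congr (nat_of_bool _)%:R; apply/idP/eqP => [/set_mem //|h].
exact/mem_set.
Qed.

Lemma sum_pick (I : eqType) (r : seq I) (F : I -> R) v : uniq r -> v \in r ->
  \sum_(i <- r) F i * (v == i)%:R = F v.
Proof.
move=> ur vr; rewrite (big_rem v vr) /= eqxx mulr1 big_seq big1 ?addr0 // => i.
by rewrite mem_rem_uniq // inE eq_sym => /andP[/negbTE -> _]; rewrite mulr0.
Qed.

Lemma measurable_preimage1 Y v : measurable_fun setT Y -> measurable (Y @^-1` [set v]).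
Proof. by move=> mY; rewrite -[X in measurable X]setTI; apply: mY. Qed.

Lemma integral_supported Y s k : measurable_fun setT Y -> supported Y s ->
  (\int[P]_w (Y w ^+ k)%:E)%E = (\sum_(v <- s) v ^+ k * mass Y v)%:E.
Proof.
move=> mY [us hs]; apply: integral_ae_simple.
- exact: measurable_realfun.measurable_funX.
- by move=> v; apply: measurable_preimage1.
apply: filterS hs => w hw.
rewrite -(sum_pick (fun v => v ^+ k) us hw); apply: eq_bigr => v _.
by rewrite indic_preimage1.
Qed.

Lemma measurable_seq s : measurable (~` [set` s] : set R).
Proof.
apply: measurableC; elim: s => [|v s ih].
  by rewrite (_ : [set` _] = set0) //; apply/seteqP; split.
rewrite (_ : [set` _] = [set v] `|` [set` s]); first exact: measurableU.
apply/seteqP; split => x /=; rewrite inE; first by case/orP => [/eqP|]; [left|right].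
by case=> [->|->]; rewrite ?eqxx ?orbT.
Qed.

(** Turns almost sure membership into the vanishing of the probability of one measurable set, which
    depends only on the distribution. *)
Lemma supportedP Y s : measurable_fun setT Y ->
  {ae P, forall w, Y w \in s} <-> P (Y @^-1` (~` [set` s])) = 0%E.
Proof.
move=> mY; have mS : measurable (Y @^-1` (~` [set` s])).
  by rewrite -[X in measurable X]setTI; apply: mY => //; exact: measurable_seq.
have -> : {ae P, forall w, Y w \in s} <-> P.-negligible (Y @^-1` (~` [set` s])) by [].
by split => [/measure_negligible -> //|h]; apply/negligibleP.
Qed.

Lemma supported_same_distribution Y Z s : measurable_fun setT Y -> measurable_fun setT Z ->
  same_distribution P Y Z -> supported Z s -> supported Y s.
Proof.
move=> mY mZ h [us /(supportedP _ mZ) hs]; split => //; apply/(supportedP _ mY).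
by rewrite h //; exact: measurable_seq.
Qed.

Lemma mass_same_distribution Y Z v : same_distribution P Y Z -> mass Y v = mass Z v.
Proof. by move=> h; rewrite /mass h. Qed.

Lemma integral_same_distribution Y Z s k : measurable_fun setT Y -> measurable_fun setT Z ->
  same_distribution P Y Z -> supported Z s ->
  (\int[P]_w (Y w ^+ k)%:E = \int[P]_w (Z w ^+ k)%:E)%E.
Proof.
move=> mY mZ h sZ; have sY := supported_same_distribution mY mZ h sZ.
rewrite (integral_supported k mY sY) (integral_supported k mZ sZ).
by congr EFin; apply: eq_bigr => v _; rewrite (mass_same_distribution v h).
Qed.

Lemma measurable_fun_select (F : nat -> T -> R) (K : {RV P >-> nat}) :
  (forall k, measurable_fun setT (F k)) -> measurable_fun setT (fun w => F (K w) w).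
Proof.
move=> mF _ B mB; rewrite setTI.
have -> : (fun w => F (K w) w) @^-1` B = \bigcup_k (K @^-1` [set k] `&` F k @^-1` B).
  apply/seteqP; split => [w /= h|w [k _] [/= -> //]]; by exists (K w).
apply: bigcup_measurable => k _; apply: measurableI.
  exact: measurable_funPTI.
by rewrite -[X in measurable X]setTI; apply: mF.
Qed.

End FiniteSupport.

Lemma exchange_sum4 (R : realType) (I J : Type) (r1 : seq I) (r2 : seq J) n
    (F : I -> J -> nat -> nat -> R) :
  \sum_(x <- r1) \sum_(y <- r2) \sum_(i < n) \sum_(j < i.+1) F x y i j =
  \sum_(i < n) \sum_(j < i.+1) \sum_(x <- r1) \sum_(y <- r2) F x y i j.
Proof.
transitivity (\sum_(x <- r1) \sum_(i < n) \sum_(j < i.+1) \sum_(y <- r2) F x y i j).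
  by apply: eq_bigr => x _; rewrite exchange_big; apply: eq_bigr => i _; rewrite exchange_big.
by rewrite exchange_big; apply: eq_bigr => i _; rewrite exchange_big.
Qed.

(** * Finite supports and the recurrence for the moments *)

Section Moments.
Context (d : measure_display) (T : measurableType d) (R : realType).
Variables (P : probability T R) (M : tree_model) (t : nat -> R).
Variables (X Xt : nat -> {RV P >-> R}) (K : nat -> {RV P >-> nat}).
Hypothesis hX : tree_recurrence M t X Xt K.

Let a := Defs.shift M.

(** Both parts of the split are then indices at which an induction hypothesis is available. *)
Definition split_ok n k := [&& (base M <= k < n)%N, (base M <= n - a - k)%N & (n - a - k < n)%N].

Lemma split_prob_notok n k : (base M < n)%N -> ~~ split_ok n k -> split_prob R M n k = 0.
Proof.
rewrite /split_ok /a; case: M => /= h hk; case: ifP => // hkn; case/negP: hk; lia.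
Qed.

Lemma ae_index_ok n : (base M < n)%N -> {ae P, forall w, split_ok n (K n w)}.
Proof.
move=> hn.
have h k : {ae P, forall w, K n w = k -> split_ok n k}.
  have [ok|nok] := boolP (split_ok n k); first by apply: aeW.
  have : P.-negligible (K n @^-1` [set k]).
    apply/negligibleP; first exact: measurable_funPTI.
    by have := index_distribution hX k hn; rewrite split_prob_notok.
  apply: negligibleS => w /= hw; apply: contrapT => hk; apply: hw => E.
  by case: hk.
by have /ae_foralln := h; apply: filterS => w hw; exact: hw.
Qed.

Lemma independent_mass n k m (x y : R) : (base M < n)%N ->
  fine (P (X k @^-1` [set x] `&` Xt m @^-1` [set y] `&` K n @^-1` [set k])) =
  mass P (X k) x * mass P (X m) y * split_prob R M n k.
Proof.
move=> hn; have -> := @index_independent _ _ _ _ _ _ _ _ _ hX n hn; first last.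
- by exists [set k] => //; rewrite setTI.
- by apply: sub_sigma_algebra; exists m => //; exists [set y] => //; rewrite setTI.
- by apply: sub_sigma_algebra; exists k => //; exists [set x] => //; rewrite setTI.
rewrite (mass_same_distribution y (copy_distribution hX m)) (index_distribution hX) //.
by rewrite !fineM ?fin_numM // fin_num_measure //; exact: measurable_preimage1.
Qed.

Let Y n w := t n + X (K n w) w + Xt (n - a - K n w)%N w.

Lemma measurable_recurrence n : measurable_fun setT (Y n).
Proof.
apply: (@measurable_fun_select _ _ _ P (fun k w => t n + X k w + Xt (n - a - k)%N w) (K n)).
by move=> k; apply: measurable_realfun.measurable_funD => //; apply: measurable_realfun.measurable_funD.
Qed.

Section Step.
Variables (n : nat) (s : nat -> seq R).
Hypothesis hn : (base M < n)%N.
Hypothesis hs : forall k, (base M <= k < n)%N -> supported P (X k) (s k).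

Lemma ae_step_support : {ae P, forall w, split_ok n (K n w) /\
  X (K n w) w \in s (K n w) /\ Xt (n - a - K n w)%N w \in s (n - a - K n w)%N}.
Proof.
have h k : {ae P, forall w, split_ok n k -> X k w \in s k /\ Xt (n - a - k)%N w \in s (n - a - k)%N}.
  have [ok|nok] := boolP (split_ok n k); last by apply: aeW.
  have /and3P[h1 h2 h3] := ok.
  have [_ hx] := hs h1.
  have [_ hy] : supported P (Xt (n - a - k)%N) (s (n - a - k)%N).
    apply: (supported_same_distribution _ _ _ (hs _)) => //; last by rewrite h2 h3.
    by move=> B mB; rewrite (copy_distribution hX).
  by apply: filterS2 hx hy => w hxw hyw _.
have /ae_foralln h' := h.
apply: filterS2 (ae_index_ok hn) h' => w hk hw; split => //; exact: hw.
Qed.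

Let ks := [seq k <- iota 0 n | split_ok n k].

Lemma supported_step :
  supported P (X n) (undup [seq t n + p.1 + p.2 | p <-
    flatten [seq [seq (x, y) | x <- s k, y <- s (n - a - k)%N] | k <- ks]]).
Proof.
apply: (supported_same_distribution _ (measurable_recurrence n) (recurrence hX hn)) => //.
split; first exact: undup_uniq.
apply: filterS ae_step_support => w [hk [hx hy]]; rewrite mem_undup.
apply/mapP; exists (X (K n w) w, Xt (n - a - K n w)%N w) => //.
apply/flatten_mapP; exists (K n w).
  by rewrite mem_filter hk mem_iota; have /and3P[/andP[_ ->] _ _] := hk.
by apply: allpairs_f.
Qed.

Lemma integral_step r : (\int[P]_w (X n w ^+ r)%:E)%E =
  (\sum_(k <- ks) \sum_(x <- s k) \sum_(y <- s (n - a - k)%N)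
    (t n + x + y) ^+ r * (mass P (X k) x * mass P (X (n - a - k)%N) y * split_prob R M n k))%:E.
Proof.
have sY : supported P (Y n) (undup [seq t n + p.1 + p.2 | p <-
    flatten [seq [seq (x, y) | x <- s k, y <- s (n - a - k)%N] | k <- ks]]).
  apply: (supported_same_distribution (measurable_recurrence n) _ _ supported_step) => //.
  by move=> B mB; rewrite (recurrence hX hn).
rewrite (integral_same_distribution r _ (measurable_recurrence n) (recurrence hX hn) sY) //.
pose E (i : nat * R * R) := X i.1.1 @^-1` [set i.1.2] `&`
  Xt (n - a - i.1.1)%N @^-1` [set i.2] `&` K n @^-1` [set i.1.1].
pose c (i : nat * R * R) := (t n + i.1.2 + i.2) ^+ r.
pose rs := [seq i | p <- [seq (k, x) | k <- ks, x <- s k], i <- [seq (p, y) | y <- s (n - a - p.1)%N]].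
have rsE (F : nat * R * R -> R) : \sum_(i <- rs) F i =
    \sum_(k <- ks) \sum_(x <- s k) \sum_(y <- s (n - a - k)%N) F (k, x, y).
  rewrite /rs big_allpairs_dep big_allpairs_dep /=.
  by apply: eq_bigr => k _; apply: eq_bigr => x _; rewrite big_map.
rewrite (@integral_ae_simple _ _ _ P _ rs c E).
- rewrite rsE; congr EFin; apply: eq_bigr => k _; apply: eq_bigr => x _; apply: eq_bigr => y _.
  by rewrite /c /E /= independent_mass.
- exact/measurable_realfun.measurable_funX/measurable_recurrence.
- by move=> i; apply: measurableI; [apply: measurableI|]; exact: measurable_funPTI.
apply: filterS ae_step_support => w [hk [hx hy]].
have hK : K n w \in ks.
  by rewrite mem_filter hk mem_iota; have /and3P[/andP[_ ->] _ _] := hk.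
have us k : split_ok n k -> uniq (s k) /\ uniq (s (n - a - k)%N).
  by move=> /and3P[h1 h2 h3]; split; [have [] := hs h1|have [] := hs (_ : (base M <= n - a - k < n)%N); rewrite ?h2 ?h3].
have [u1 u2] := us _ hk.
rewrite rsE /Y.
(* Only the triple of values actually taken at [w] survives; it is picked out one coordinate at a
   time. *)
transitivity (\sum_(k <- ks) (\sum_(x <- s k) (\sum_(y <- s (n - a - k)%N)
   (t n + x + y) ^+ r * (Xt (n - a - k)%N w == y)%:R) * (X k w == x)%:R) * (K n w == k)%:R); last first.
  apply: eq_bigr => k _; rewrite mulr_suml; apply: eq_bigr => x _.
  rewrite !mulr_suml; apply: eq_bigr => y _.
  by rewrite /E /c !indicI /= !indic_preimage1; ring.
rewrite (sum_pick (fun k => \sum_(x <- s k) (\sum_(y <- s (n - a - k)%N)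
   (t n + x + y) ^+ r * (Xt (n - a - k)%N w == y)%:R) * (X k w == x)%:R) _ hK); last first.
  by rewrite filter_uniq // iota_uniq.
rewrite (sum_pick (fun x => \sum_(y <- _) _ * _) u1 hx).
by rewrite (sum_pick (fun y => (_ + y) ^+ r) u2 hy).
Qed.

End Step.

Definition moment r n : R := fine 'E_P[fun w => (X n w ^+ r)%R]%E.

Lemma supported_tree n : (base M <= n)%N -> exists s, supported P (X n) s.
Proof.
elim/ltn_ind: n => n ih; rewrite leq_eqVlt => /orP[/eqP <-|hn].
  exists [:: t (base M)]; split => //; apply: filterS (initial_value hX) => w ->.
  by rewrite mem_seq1.
have /choice[s hs] : forall k, exists s, (base M <= k < n)%N -> supported P (X k) s.
  move=> k; have [/andP[h1 h2]|h] := boolP (base M <= k < n)%N; last by exists [::].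
  by have [s hs] := ih k h2 h1; exists s.
by eexists; exact: supported_step hn hs.
Qed.

Lemma momentE s r n : supported P (X n) s ->
  moment r n = \sum_(v <- s) v ^+ r * mass P (X n) v.
Proof. by move=> h; rewrite /moment unlock (integral_supported r _ h). Qed.

Lemma moment_fin_num r n : (base M <= n)%N -> 'E_P[fun w => (X n w ^+ r)%R]%E \is a fin_num.
Proof.
by move=> /supported_tree[s hs]; rewrite unlock (integral_supported r _ hs).
Qed.

Lemma moment0 n : moment 0 n = 1.
Proof.
rewrite /moment (_ : (fun w => X n w ^+ 0) = cst 1); last by apply/funext => w; rewrite expr0.
by rewrite expectation_cst.
Qed.

(** The binomial theorem is applied twice, to [t + (x + y)] and to [x + y]; independence has already
    factored the joint masses in [integral_step]. *)
Lemma moment_rec r n : (base M < n)%N -> moment r n =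
  \sum_(i < r.+1) \sum_(j < i.+1) ('C(r, i)%:R * 'C(i, j)%:R) *
    (t n ^+ (r - i) * split_conv M (moment (i - j)) (moment j) n).
Proof.
move=> hn.
have /choice[s hs] : forall k, exists s, (base M <= k)%N -> supported P (X k) s.
  move=> k; have [h|h] := boolP (base M <= k)%N; last by exists [::].
  by have [s hs] := supported_tree h; exists s.
have hs' k : (base M <= k < n)%N -> supported P (X k) (s k).
  by move=> /andP[h _]; exact: hs.
rewrite {1}/moment unlock (integral_step hn hs') /=.
transitivity (\sum_(k < n) split_prob R M n k * \sum_(i < r.+1) \sum_(j < i.+1)
   ('C(r, i)%:R * 'C(i, j)%:R) * (t n ^+ (r - i) * (moment (i - j) k * moment j (n - a - k)%N))).
  rewrite big_filter big_mkcond /= -[X in iota 0 X]subn0 big_mkord; apply: eq_bigr => k _.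
  case: ifPn => [/and3P[h1 h2 h3]|h]; last by rewrite split_prob_notok // mul0r.
  have sk := hs' k h1; have sm : supported P (X (n - a - k)%N) (s (n - a - k)%N).
    by apply: hs'; rewrite h2 h3.
  transitivity (\sum_(x <- s k) \sum_(y <- s (n - a - k)%N) \sum_(i < r.+1) \sum_(j < i.+1)
     split_prob R M n k * (('C(r, i)%:R * 'C(i, j)%:R) * (t n ^+ (r - i) *
       ((x ^+ (i - j) * mass P (X k) x) * (y ^+ j * mass P (X (n - a - k)%N) y))))).
    apply: eq_bigr => x _; apply: eq_bigr => y _.
    rewrite -addrA exprDn mulr_suml; apply: eq_bigr => i _.
    rewrite -mulr_natr exprDn mulr_sumr !mulr_suml; apply: eq_bigr => j _.
    by rewrite -[x ^+ _ * _ *+ _]mulr_natr; ring.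
  rewrite (exchange_sum4 _ _ _ (fun x y i j => split_prob R M n k * (('C(r, i)%:R * 'C(i, j)%:R) *
    (t n ^+ (r - i) * ((x ^+ (i - j) * mass P (X k) x) * (y ^+ j * mass P (X (n - a - k)%N) y)))))).
  rewrite mulr_sumr; apply: eq_bigr => i _.
  rewrite mulr_sumr; apply: eq_bigr => j _.
  rewrite (momentE _ sk) (momentE _ sm) mulr_suml !mulr_sumr.
  by apply: eq_bigr => x _; rewrite !mulr_sumr.
transitivity (\sum_(k < n) \sum_(i < r.+1) \sum_(j < i.+1) split_prob R M n k *
   (('C(r, i)%:R * 'C(i, j)%:R) * (t n ^+ (r - i) * (moment (i - j) k * moment j (n - a - k)%N)))).
  by apply: eq_bigr => k _; rewrite mulr_sumr; apply: eq_bigr => i _; rewrite mulr_sumr.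
rewrite exchange_big; apply: eq_bigr => i _; rewrite exchange_big; apply: eq_bigr => j _.
by rewrite /split_conv !mulr_sumr; apply: eq_bigr => k _; rewrite -/a; ring.
Qed.

End Moments.

(** * Induction on the order of the moments *)

Lemma expandable_split_conv (R : realType) (M : tree_model) (u v : nat -> R) :
  expandable u -> expandable v -> expandable (split_conv M u v).
Proof.
move=> hu hv; case: M; last 2 first.
- exact: expandable_split_conv_UniformBinary.
- exact: expandable_split_conv_UnionFind.
apply: expandable_unshift.
have := expandableM (expandable_natDV (1 : R)) (expandableM_conv hu hv).
by congr expandable; apply/funext => n; rewrite split_conv_BST natr1.
Qed.

Lemma split_transfer (R : realType) (M : tree_model) (f g : nat -> R) :
  (forall n, (base M < n)%N -> split_conv M (fun=> 1) (fun=> 1) n = 1 :> R) ->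
  expandable g ->
  (forall n, (base M < n)%N ->
    f n = g n + (split_conv M f (fun=> 1) n + split_conv M (fun=> 1) f n)) ->
  expandable f.
Proof.
case: M => total hg hf.
- exact: BST_transfer hg hf.
- exact: UniformBinary_transfer hg hf.
- exact: (@UnionFind_transfer R total f g hg hf).
Qed.

Lemma expandable_toll (R : realType) (t : nat -> R) : admissible_toll t -> expandable t.
Proof.
case=> [[alpha _ ->]|->].
  have := expandable_powD (0 : R) alpha; congr expandable; apply/funext => n.
  by rewrite addr0.
by apply: (expandable_eventually_eq (N := 1)) (expandable_ln R) => -[].
Qed.

Lemma expandable_moment (d : measure_display) (T : measurableType d) (R : realType)
    (P : probability T R) (M : tree_model) (t : nat -> R)
    (X Xt : nat -> {RV P >-> R}) (K : nat -> {RV P >-> nat}) :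
  admissible_toll t -> tree_recurrence M t X Xt K -> forall s, expandable (moment X s).
Proof.
move=> /expandable_toll ht hX.
have m0 : moment X 0 = fun=> 1 by apply/funext => n; exact: moment0.
elim/ltn_ind => -[_|s ih]; first by rewrite m0; exact: expandable_cst.
pose c i j n := ('C(s.+1, i)%:R * 'C(i, j)%:R) *
  (t n ^+ (s.+1 - i) * split_conv M (moment X (i - j)) (moment X j) n).
have hc i j : (i - j <= s)%N -> (j <= s)%N -> expandable (c i j).
  move=> h1 h2; apply: expandableZ; apply: expandableM; first exact: expandableX.
  by apply: expandable_split_conv; exact: ih.
(* The moment of order [s.+1] itself occurs only for [i = s.+1] with [j = 0] or [j = s.+1]; all
   other terms involve lower moments and form the inhomogeneous part. *)
apply: (@split_transfer _ M _
  (fun n => \sum_(i < s.+1) \sum_(j < i.+1) c i j n + \sum_(j < s) c s.+1 j.+1 n)).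
(* The recurrence for the moment of order 0 says that the masses add up to 1. *)
- by move=> n hn; have := moment_rec hX 0 hn; rewrite !big_ord1 /= !subn0 m0 !bin0 expr0 !mul1r => <-.
- apply: expandableD; apply: expandable_sum => i _; last by apply: hc; have := ltn_ord i; lia.
  by apply: expandable_sum => j _; apply: hc; have := ltn_ord i; have := ltn_ord j; lia.
move=> n hn; rewrite (moment_rec hX s.+1 hn) big_ord_recr /= -addrA; congr (_ + _).
rewrite big_ord_recl big_ord_recr /= addrCA addrA [RHS]addrA.
congr (_ + _ + _).
  by rewrite subnn subn0 bin0 binn expr0 m0 !mul1r.
by rewrite /bump leq0n add1n subnn binn expr0 m0 !mul1r.
Qed.

Theorem theorem9 (R : realType) (d : measure_display) (T : measurableType d)
    (P : probability T R) (M : tree_model) (t : nat -> R)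
    (X Xt : nat -> {RV P >-> R}) (K : nat -> {RV P >-> nat})
    (ht : admissible_toll t) (hX : tree_recurrence M t X Xt K)
    (s : nat) (hs : (0 < s)%N) :
  (forall n, (base M <= n)%N -> 'E_P[fun w => (X n w ^+ s)%R]%E \is a fin_num) /\
  complete_expansion (fun n => fine 'E_P[fun w => (X n w ^+ s)%R]%E).
Proof.
split; first by move=> n; exact: (moment_fin_num hX s).
exact/expandable_complete_expansion/(expandable_moment ht hX).
Qed.
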